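(* Let $(T,m)$ be a commutative Noetherian local ring with $\dim T \ge 2$. Let $R=T[x_1,\dots,x_n]$ be a polynomial ring in $n$ variables over $T$, graded by $\deg T=0$ and $\deg x_i=1$ for all $i$, let $I=(x_1,\dots,x_n)R$, and let $P=mR+I$ be the homogeneous maximal ideal of $R$. Let $f\in R$ be a homogeneous polynomial whose nonzero coefficients form a system of parameters for $T$. Then the $^*$socle of the local cohomology module $H^n_I(R/fR)$, namely $\operatorname{Hom}_R(R/P,H^n_I(R/fR))\cong\{z\in H^n_I(R/fR)\mid Pz=0\}$, is infinite dimensional as a vector space over $R/P\cong T/m$.
   Context: All rings are commutative with identity. $H^i_I(M)$ denotes the $i$-th local cohomology module of $M$ with support in $I$. For a graded $R$-module $N$, the $^*$socle of $N$ is the submodule $\{z\in N\mid Pz=0\}\cong\operatorname{Hom}_R(R/P,N)$, which is a vector space over $R/P$. Saying that the nonzero coefficients of $f$ form a system of parameters for $T$ means that $f$ has exactly $d=\dim T$ nonzero coefficients $c_1,\dots,c_d$ (one for each monomial in $x_1,\dots,x_n$ occurring in $f$) and that the ideal $(c_1,\dots,c_d)T$ is $m$-primary. *)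

(* Defs.v *)
From HB Require Import structures.
From mathcomp Require Import all_boot all_order all_algebra.
From mathcomp Require Export boolp mpoly.

Set Implicit Arguments.
Unset Strict Implicit.
Unset Printing Implicit Defensive.

Import GRing.Theory.
Local Open Scope ring_scope.
Local Open Scope quotient_scope.

(* Submodules and ideals are Prop-valued; [subm N] and [quotm N] below go
   through [asbool] to obtain carrier types with mathcomp structures. *)
Record submod (R : comNzRingType) (V : lmodType R) := Submod {
  smem :> V -> Prop;
  smem0 : smem 0;
  smemD : forall x y, smem x -> smem y -> smem (x + y);
  smemZ : forall a x, smem x -> smem (a *: x)
}.

Definition ideal (R : comNzRingType) := submod (R^o : lmodType R).

Section SubmoduleType.
Variables (R : comNzRingType) (V : lmodType R) (N : submod V).

Definition smem_pred : {pred V} := fun x => `[< N x >].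

Lemma smem_predP : submod_closed smem_pred.
Proof.
split; first by apply/asboolP; exact: smem0.
move=> a x y /asboolP Nx /asboolP Ny; apply/asboolP.
by apply: smemD => //; apply: smemZ.
Qed.

HB.instance Definition _ := GRing.isSubmodClosed.Build R V smem_pred smem_predP.

Record subm := SubM { subm_val : V; subm_valP : subm_val \in smem_pred }.

HB.instance Definition _ := [isSub for subm_val].
HB.instance Definition _ := [Choice of subm by <:].
HB.instance Definition _ := [SubChoice_isSubLmodule of subm by <:].

End SubmoduleType.

Section QuotientModule.
Variables (R : comNzRingType) (V : lmodType R) (N : submod V).

Definition quotm_rel : rel V := fun x y => `[< N (x - y) >].

Lemma smemN x : N x -> N (- x).
Proof. by move=> Nx; rewrite -scaleN1r; apply: smemZ. Qed.

Lemma quotm_rel_refl : reflexive quotm_rel.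
Proof. by move=> x; apply/asboolP; rewrite subrr; exact: smem0. Qed.

Lemma quotm_rel_sym : ssrbool.symmetric quotm_rel.
Proof.
by move=> x y; apply/asboolP/asboolP => /smemN; rewrite opprB.
Qed.

Lemma quotm_rel_trans : transitive quotm_rel.
Proof.
move=> y x z /asboolP xy /asboolP yz; apply/asboolP.
by rewrite -(subrKA y); apply: smemD.
Qed.

Canonical quotm_equiv :=
  EquivRel quotm_rel quotm_rel_refl quotm_rel_sym quotm_rel_trans.

Definition quotm := {eq_quot quotm_equiv}.

HB.instance Definition _ := Choice.on quotm.

Definition quotm_pi (x : V) : quotm := \pi_quotm x.

Lemma quotm_piP x y : quotm_pi x = quotm_pi y <-> N (x - y).
Proof.
split=> [/eqmodP /asboolP //|Nxy].
by apply/eqmodP/asboolP.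
Qed.

Lemma quotm_reprK z : quotm_pi (repr z) = z.
Proof. exact: reprK. Qed.

Lemma quotm_pi_repr x : N (repr (quotm_pi x) - x).
Proof. by apply/quotm_piP; rewrite quotm_reprK. Qed.

Definition quotm_add (x y : quotm) := quotm_pi (repr x + repr y).
Definition quotm_opp (x : quotm) := quotm_pi (- repr x).
Definition quotm_scale (a : R) (x : quotm) := quotm_pi (a *: repr x).

Lemma quotm_piD x y : quotm_pi (x + y) = quotm_add (quotm_pi x) (quotm_pi y).
Proof.
apply/esym/quotm_piP; rewrite opprD addrACA.
by apply: smemD; exact: quotm_pi_repr.
Qed.

Lemma quotm_piN x : quotm_pi (- x) = quotm_opp (quotm_pi x).
Proof.
apply/esym/quotm_piP; rewrite -opprD.
by apply: smemN; exact: quotm_pi_repr.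
Qed.

Lemma quotm_piZ a x : quotm_pi (a *: x) = quotm_scale a (quotm_pi x).
Proof.
apply/esym/quotm_piP; rewrite -scalerBr.
by apply: smemZ; exact: quotm_pi_repr.
Qed.

Lemma quotm_ind (A : quotm -> Prop) : (forall x, A (quotm_pi x)) -> forall z, A z.
Proof. by move=> h z; rewrite -[z]quotm_reprK. Qed.

Lemma quotm_addA : associative quotm_add.
Proof.
move=> x y z; elim/quotm_ind: x => x; elim/quotm_ind: y => y; elim/quotm_ind: z => z.
by rewrite -!quotm_piD addrA.
Qed.

Lemma quotm_addC : commutative quotm_add.
Proof.
by move=> x y; elim/quotm_ind: x => x; elim/quotm_ind: y => y; rewrite -!quotm_piD addrC.
Qed.

Lemma quotm_add0 : left_id (quotm_pi 0) quotm_add.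
Proof. by move=> x; elim/quotm_ind: x => x; rewrite -quotm_piD add0r. Qed.

Lemma quotm_addN : left_inverse (quotm_pi 0) quotm_opp quotm_add.
Proof. by move=> x; elim/quotm_ind: x => x; rewrite -quotm_piN -quotm_piD addNr. Qed.

HB.instance Definition _ :=
  GRing.isZmodule.Build quotm quotm_addA quotm_addC quotm_add0 quotm_addN.

Lemma quotm_scaleA a b z :
  quotm_scale a (quotm_scale b z) = quotm_scale (a * b) z.
Proof. by elim/quotm_ind: z => x; rewrite -!quotm_piZ scalerA. Qed.

Lemma quotm_scale1 : left_id 1 quotm_scale.
Proof. by move=> x; elim/quotm_ind: x => x; rewrite -quotm_piZ scale1r. Qed.

Lemma quotm_scaleDr : right_distributive quotm_scale +%R.
Proof.
move=> a; elim/quotm_ind=> x; elim/quotm_ind=> y.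
by rewrite -[_ + _ in LHS]quotm_piD -!quotm_piZ -[RHS]quotm_piD scalerDr.
Qed.

Lemma quotm_scaleDl z : {morph quotm_scale^~ z : a b / a + b}.
Proof.
move=> a b; elim/quotm_ind: z => x.
by rewrite -!quotm_piZ -[RHS]quotm_piD scalerDl.
Qed.

HB.instance Definition _ :=
  GRing.Zmodule_isLmodule.Build R quotm
    quotm_scaleA quotm_scale1 quotm_scaleDr quotm_scaleDl.

End QuotientModule.

Section QuotientRing.
Variables (R : comNzRingType) (J : ideal R).

(* A pzRing: J is not assumed proper. *)
Definition quotring := quotm J.

HB.instance Definition _ := GRing.Zmodule.on quotring.

Definition quotring_pi (r : R) : quotring := quotm_pi J r.
Lemma quotring_ind (A : quotring -> Prop) :
  (forall r, A (quotring_pi r)) -> forall a, A a.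
Proof. by move=> h a; rewrite -[a]quotm_reprK; apply: h. Qed.

Definition quotring_mul (a b : quotring) := quotring_pi (repr a * repr b).

Lemma quotring_piM a b :
  quotring_pi (a * b) = quotring_mul (quotring_pi a) (quotring_pi b).
Proof.
apply/esym/quotm_piP; set a' := repr _; set b' := repr _.
have -> : a' * b' - a * b = b' * (a' - a) + a * (b' - b) :> R.
  by rewrite !mulrBr [b' * a']mulrC [b' * a]mulrC addrA subrK.
by apply: smemD; apply: (@smemZ _ _ J); exact: quotm_pi_repr.
Qed.

Lemma quotring_mulA : associative quotring_mul.
Proof.
move=> x y z; elim/quotring_ind: x => x; elim/quotring_ind: y => y; elim/quotring_ind: z => z.
by rewrite -!quotring_piM mulrA.
Qed.

Lemma quotring_mulC : commutative quotring_mul.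
Proof.
by move=> x y; elim/quotring_ind: x => x; elim/quotring_ind: y => y; rewrite -!quotring_piM mulrC.
Qed.

Lemma quotring_mul1 : left_id (quotring_pi 1) quotring_mul.
Proof. by move=> x; elim/quotring_ind: x => x; rewrite -quotring_piM mul1r. Qed.

Lemma quotring_mulDl : left_distributive quotring_mul +%R.
Proof.
move=> x y z; elim/quotring_ind: x => x; elim/quotring_ind: y => y; elim/quotring_ind: z => z.
by rewrite -[_ + _ in LHS]quotm_piD -!quotring_piM -[RHS]quotm_piD -mulrDl.
Qed.

HB.instance Definition _ := GRing.Zmodule_isComPzRing.Build quotring
  quotring_mulA quotring_mulC quotring_mul1 quotring_mulDl.

End QuotientRing.

Section Ideals.
Variable R : comNzRingType.
Implicit Types (I J Q p : ideal R) (S : R -> Prop).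

Definition ideal_eq I J := forall r : R, I r <-> J r.
Definition ideal_sub I J := forall r : R, I r -> J r.

Definition ideal_gen_mem S (r : R) : Prop :=
  forall J, (forall s : R, S s -> J s) -> J r.

Lemma ideal_gen0 S : ideal_gen_mem S 0.
Proof. by move=> J _; exact: (smem0 J). Qed.

Lemma ideal_genD S x y :
  ideal_gen_mem S x -> ideal_gen_mem S y -> ideal_gen_mem S (x + y).
Proof. by move=> hx hy J hJ; apply: (smemD (hx J hJ) (hy J hJ)). Qed.

Lemma ideal_genZ S a x : ideal_gen_mem S x -> ideal_gen_mem S (a * x).
Proof. by move=> hx J hJ; apply: (smemZ a (hx J hJ)). Qed.

Definition ideal_gen S : ideal R :=
  @Submod R (R^o) (ideal_gen_mem S)
    (@ideal_gen0 S) (@ideal_genD S) (@ideal_genZ S).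

Definition ideal_pow I (t : nat) : ideal R :=
  ideal_gen (fun r => exists2 a : 'I_t -> R,
    forall i, I (a i) & r = \prod_(i < t) a i).

Definition proper_id I := ~ I 1.

Definition prime_id p :=
  proper_id p /\ forall a b : R, p (a * b) -> p a \/ p b.

Definition maximal_id I :=
  proper_id I /\
  forall J, proper_id J -> ideal_sub I J -> ideal_sub J I.

Definition primary_id Q :=
  proper_id Q /\
  forall a b : R, Q (a * b) -> Q a \/ exists k : nat, Q (b ^+ k).

(* Q is p-primary *)
Definition primary_to p Q :=
  primary_id Q /\ forall r : R, p r <-> exists k : nat, Q (r ^+ k).

Definition noetherian :=
  forall J, exists s : seq R, ideal_eq J (ideal_gen (fun r => r \in s)).

Definition is_local m :=
  maximal_id m /\ forall m', maximal_id m' -> ideal_eq m' m.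

Definition prime_chain (k : nat) (c : nat -> ideal R) :=
  (forall i, (i <= k)%N -> prime_id (c i)) /\
  (forall i, (i < k)%N ->
     ideal_sub (c i) (c i.+1) /\ ~ ideal_sub (c i.+1) (c i)).

Definition krull_dim (d : nat) :=
  (exists c, prime_chain d c) /\ ~ (exists c, prime_chain d.+1 c).

(* c is a system of parameters of the local ring with maximal ideal m *)
Definition system_of_parameters m (c : seq R) :=
  krull_dim (size c) /\ primary_to m (ideal_gen (fun r => r \in c)).

End Ideals.

Section LocalCohomology.
Variable R : comNzRingType.

Definition injective_module (E : lmodType R) :=
  forall (A B : lmodType R) (u : {linear A -> B}) (g : {linear A -> E}),
    injective u -> exists h : {linear B -> E}, forall a, h (u a) = g a.

Record injective_resolution (M : lmodType R) := InjectiveResolution {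
  ires : nat -> lmodType R;
  ires_d : forall i, {linear ires i -> ires i.+1};
  ires_aug : {linear M -> ires 0};
  ires_inj : forall i, injective_module (ires i);
  ires_aug_inj : injective ires_aug;
  ires_exact0 : forall z, ires_d 0 z = 0 <-> exists x, z = ires_aug x;
  ires_exact : forall i z, ires_d i.+1 z = 0 <-> exists y, z = ires_d i y
}.

Section Gamma.
Variables (I : ideal R) (V : lmodType R).

Definition gamma_mem (z : V) : Prop :=
  exists t : nat, forall r : R, ideal_pow I t r -> r *: z = 0.

End Gamma.

Lemma ideal_pow_le (I : ideal R) s t :
  (s <= t)%N -> ideal_sub (ideal_pow I t) (ideal_pow I s).
Proof.
move=> st r hr; apply: hr => _ [a Ia ->] J hJ.
rewrite -(subnKC st) in a Ia *; rewrite big_split_ord /= mulrC.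
apply: (@smemZ _ _ J); apply: hJ.
by exists (fun i => a (lshift _ i)).
Qed.

Lemma gamma0 I V : @gamma_mem I V 0.
Proof. by exists 0%N => r _; rewrite scaler0. Qed.

Lemma gammaD I V x y :
  @gamma_mem I V x -> @gamma_mem I V y -> @gamma_mem I V (x + y).
Proof.
move=> [s hs] [t ht]; exists (maxn s t) => r hr.
rewrite scalerDr hs ?ht ?addr0 //.
  by apply: ideal_pow_le hr; exact: leq_maxr.
by apply: ideal_pow_le hr; exact: leq_maxl.
Qed.

Lemma gammaZ I V a x : @gamma_mem I V x -> @gamma_mem I V (a *: x).
Proof.
move=> [s hs]; exists s => r hr.
by rewrite scalerA mulrC -scalerA hs // scaler0.
Qed.

(* the I-torsion functor on objects *)
Definition gamma (I : ideal R) (V : lmodType R) : submod V :=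
  Submod (@gamma0 I V) (@gammaD I V) (@gammaZ I V).

Lemma gamma_linear I (U V : lmodType R) (g : {linear U -> V}) x :
  gamma I U x -> gamma I V (g x).
Proof.
by move=> [t ht]; exists t => r hr; rewrite -linearZZ ht // linear0.
Qed.

Section Cohomology.
Variables (I : ideal R) (M : lmodType R) (E : injective_resolution M).

Definition cocycle_mem i (z : ires E i) : Prop :=
  gamma I (ires E i) z /\ ires_d E i z = 0.

Lemma cocycle0 i : @cocycle_mem i 0.
Proof. by split; [exact: smem0 | rewrite linear0]. Qed.

Lemma cocycleD i x y :
  @cocycle_mem i x -> @cocycle_mem i y -> @cocycle_mem i (x + y).
Proof.
move=> [gx dx] [gy dy]; split; first exact: smemD.
by rewrite linearD dx dy addr0.
Qed.

Lemma cocycleZ i a x : @cocycle_mem i x -> @cocycle_mem i (a *: x).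
Proof.
move=> [gx dx]; split; first exact: smemZ.
by rewrite linearZZ dx scaler0.
Qed.

Definition cocycle i : submod (ires E i) :=
  Submod (@cocycle0 i) (@cocycleD i) (@cocycleZ i).

Definition coboundary_mem i : ires E i -> Prop :=
  match i return ires E i -> Prop with
  | 0 => fun z => z = 0
  | j.+1 => fun z => exists2 y, gamma I (ires E j) y & z = ires_d E j y
  end.

Lemma coboundary0 i : @coboundary_mem i 0.
Proof.
case: i => [//|j]; exists 0; first exact: smem0.
by rewrite linear0.
Qed.

Lemma coboundaryD i x y :
  @coboundary_mem i x -> @coboundary_mem i y -> @coboundary_mem i (x + y).
Proof.
case: i x y => [|j] x y /=; first by move=> -> ->; rewrite addr0.
move=> [x' gx ->] [y' gy ->]; exists (x' + y'); first exact: gammaD.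
by rewrite linearD.
Qed.

Lemma coboundaryZ i a x : @coboundary_mem i x -> @coboundary_mem i (a *: x).
Proof.
case: i x => [|j] x /=; first by move=> ->; rewrite scaler0.
move=> [x' gx ->]; exists (a *: x'); first exact: gammaZ.
by rewrite linearZZ.
Qed.

(* coboundaries, as a submodule of the module of cocycles *)
Definition coboundary i : submod (subm (cocycle i)) :=
  @Submod R (subm (cocycle i)) (fun z => coboundary_mem (val z))
    (@coboundary0 i) (fun x y => @coboundaryD i (val x) (val y))
    (fun a x => @coboundaryZ i a (val x)).

(* H^i_I(M), the i-th cohomology of the complex gamma I (ires E _), i.e. the
   i-th right derived functor of gamma I computed from the resolution E; up to
   isomorphism it does not depend on E. *)
Definition local_cohomology i : lmodType R := quotm (coboundary i).

End Cohomology.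
End LocalCohomology.

Section Socle.
Variables (R : comNzRingType) (P : ideal R) (H : lmodType R).

Definition socle_mem (z : H) : Prop := forall r : R, P r -> r *: z = 0.

Lemma socle0 : socle_mem 0.
Proof. by move=> r _; rewrite scaler0. Qed.

Lemma socleD x y : socle_mem x -> socle_mem y -> socle_mem (x + y).
Proof. by move=> hx hy r Pr; rewrite scalerDr hx ?hy ?addr0. Qed.

Lemma socleZ a x : socle_mem x -> socle_mem (a *: x).
Proof. by move=> hx r Pr; rewrite scalerA mulrC -scalerA hx ?scaler0. Qed.

Definition socle_submod : submod H := Submod socle0 socleD socleZ.

(* A copy of [subm socle_submod] (itself a module over R), carrying the module
   structure over R/P, isomorphic to Hom_R(R/P, H). *)
Definition socle := subm socle_submod.

HB.instance Definition _ := GRing.Zmodule.on socle.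

Definition socle_scale (a : quotring P) (z : socle) : socle :=
  (repr a : R) *: (z : subm socle_submod).

Lemma socle_scale_pi r (z : socle) :
  socle_scale (quotring_pi P r) z = r *: (z : subm socle_submod).
Proof.
apply/eqP; rewrite -subr_eq0 -scalerBl; apply/eqP/val_inj.
by case: z => z /= /asboolP; apply; exact: quotm_pi_repr.
Qed.

Lemma socle_scaleA a b z :
  socle_scale a (socle_scale b z) = socle_scale (a * b) z.
Proof.
elim/quotring_ind: a => a; elim/quotring_ind: b => b.
by rewrite -[_ * _]quotring_piM !socle_scale_pi scalerA.
Qed.

Lemma socle_scale1 : left_id 1 socle_scale.
Proof. by move=> z; rewrite socle_scale_pi scale1r. Qed.

Lemma socle_scaleDr : right_distributive socle_scale +%R.
Proof. by move=> a x y; exact: scalerDr. Qed.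

Lemma socle_scaleDl z : {morph socle_scale^~ z : a b / a + b}.
Proof.
move=> a b; elim/quotring_ind: a => a; elim/quotring_ind: b => b.
by rewrite -[_ + _]quotm_piD !socle_scale_pi scalerDl.
Qed.

HB.instance Definition _ :=
  GRing.Zmodule_isLmodule.Build (quotring P) socle
    socle_scaleA socle_scale1 socle_scaleDr socle_scaleDl.

End Socle.

Definition finite_dimensional (K : pzRingType) (V : lmodType K) :=
  exists (k : nat) (v : 'I_k -> V),
    forall z, exists a : 'I_k -> K, z = \sum_(i < k) a i *: v i.

Section PolynomialRing.
Variables (T : comNzRingType) (n : nat).

Definition irrelevant_ideal : ideal {mpoly T[n]} :=
  ideal_gen (fun r => exists i : 'I_n, r = 'X_i).

(* mR + (x_1, ..., x_n)R *)
Definition homog_max_ideal (m : ideal T) : ideal {mpoly T[n]} :=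
  ideal_gen (fun r => (exists2 c : T, m c & r = c%:MP) \/ irrelevant_ideal r).

(* R/fR as an R-module *)
Definition hypersurface (f : {mpoly T[n]}) : lmodType {mpoly T[n]} :=
  quotm (ideal_gen (fun r => r = f)).

Definition nonzero_coeffs (f : {mpoly T[n]}) : seq T :=
  [seq f@_mon | mon <- msupp f].

End PolynomialRing.

(* Main.v *)
(* H^n_I(R/fR) is the cokernel of f on the inverse polynomials.  If the socle
   were finite dimensional, it would live in degrees >= - D.  Every nonzero
   element has a nonzero homogeneous multiple in the socle, and the coefficients
   of f act nilpotently in each degree, so a fixed power of them would kill the
   whole module.  Testing this against the cofactor of c1 X^a1 + c2 X^a2 in
   (c1 X^a1)^s - (- c2 X^a2)^s, modulo a prime P containing the other
   coefficients, yields k with (c1, c2)^(s + k) contained in (c1^s, c2^s) + P for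
   all s.  Then the length h(s) of T/((c1, c2)^s + P) satisfies
   h(2s) <= 3 h(s) + O(s), whereas h grows quadratically when P is chosen, by
   Krull's principal ideal theorem, so that T/P has dimension at least 2. *)

From HB Require Import structures.
Require Import Defs.
From mathcomp Require Import all_boot all_order all_algebra.
From mathcomp Require Import boolp mpoly.
From mathcomp Require Import ring zify.

Set Implicit Arguments.
Unset Strict Implicit.
Unset Printing Implicit Defensive.

Import Order.TTheory GRing.Theory.
Local Open Scope ring_scope.

(** * Ideals and noetherian induction *)

(** An arbitrary injective resolution gives local cohomology neither explicit elements nor a
    grading. Both are recovered from fractions: regularity of the variables makes the terms of the
    resolution divisible, so connecting maps can be followed by hand, and the degree of a class is
    read off a homogeneous numerator. Finite dimension gives the socle a common denominator;
    homogeneity of the relations turns this into a degree bound. Conversely, elements of [T] are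
    recovered by a pairing: a polynomial [w] with all coefficients of [f * w] in an ideal [J]
    defines a functional modulo [J] on inverse polynomials modulo [f]. The cofactor of the overview
    is such a [w], with [J] generated by [c1 ^+ s], [c2 ^+ s] and [P]. Lengths are localized because
    Krull's theorem is applied at primes below the maximal ideal. *)

Section IdealCalculus.
Variable T : comNzRingType.
Implicit Types (A B C K M P : ideal T) (x y z r s t : T).

Lemma ideal_mull A t x : A x -> A (t * x).
Proof. exact: (@smemZ _ _ A). Qed.

Lemma ideal_mulr A t x : A x -> A (x * t).
Proof. by rewrite mulrC; exact: ideal_mull. Qed.

Lemma idealN A x : A x -> A (- x).
Proof. by move=> Ax; rewrite -mulN1r; apply: ideal_mull. Qed.

Lemma idealB A x y : A x -> A y -> A (x - y).
Proof. by move=> Ax Ay; apply: smemD => //; apply: idealN. Qed.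

Lemma ideal_sum A (I : Type) (l : seq I) (Q : pred I) (F : I -> T) :
  (forall i, Q i -> A (F i)) -> A (\sum_(i <- l | Q i) F i).
Proof.
move=> AF; apply: (big_ind (fun x => A x)) => //; first exact: (smem0 A).
by move=> x y; exact: (smemD (s := A)).
Qed.

Definition mkideal (A : T -> Prop) (h0 : A 0) (hD : forall x y, A x -> A y -> A (x + y))
  (hZ : forall a x, A x -> A (a * x)) : ideal T := @Submod T T^o A h0 hD hZ.

Definition whole : ideal T.
Proof. by apply: (@mkideal (fun _ => True)). Defined.

Definition icap A B : ideal T.
Proof.
apply: (@mkideal (fun r => A r /\ B r)).
- by split; exact: smem0.
- by move=> x y [Ax Bx] [Ay By]; split; exact: smemD.
- by move=> a x [Ax Bx]; split; exact: ideal_mull.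
Defined.

Definition iadd A B : ideal T.
Proof.
apply: (@mkideal (fun r => exists a b, [/\ A a, B b & r = a + b])).
- by exists 0, 0; split; [exact: smem0 | exact: smem0 | rewrite addr0].
- move=> _ _ [a [b [Aa Bb ->]]] [a' [b' [Aa' Bb' ->]]].
  by exists (a + a'), (b + b'); split; [exact: smemD | exact: smemD | rewrite addrACA].
- move=> t _ [a [b [Aa Bb ->]]].
  by exists (t * a), (t * b); split; [exact: ideal_mull | exact: ideal_mull | rewrite mulrDr].
Defined.

Definition imul z A : ideal T.
Proof.
apply: (@mkideal (fun r => exists2 a, A a & r = z * a)).
- by exists 0; [exact: smem0 | rewrite mulr0].
- by move=> _ _ [a Aa ->] [b Ab ->]; exists (a + b); [exact: smemD | rewrite mulrDr].
- by move=> t _ [a Aa ->]; exists (t * a); [exact: ideal_mull | rewrite mulrCA].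
Defined.

Definition icolon A z : ideal T.
Proof.
apply: (@mkideal (fun r => A (z * r))).
- by rewrite mulr0; exact: smem0.
- by move=> x y Ax Ay; rewrite mulrDr; exact: smemD.
- by move=> t x Ax; rewrite mulrCA; exact: ideal_mull.
Defined.

Definition iadj A z : ideal T := iadd (imul z whole) A.

Lemma iadjP A z r : iadj A z r <-> exists t a, A a /\ r = z * t + a.
Proof.
split; first by move=> [_ [a [[t _ ->] Aa ->]]]; exists t, a.
by move=> [t [a [Aa ->]]]; exists (z * t), a; split=> //; exists t.
Qed.

Lemma iadj_sub A z : ideal_sub A (iadj A z).
Proof. by move=> r Ar; apply/iadjP; exists 0, r; rewrite mulr0 add0r. Qed.

Lemma iadj_mem A z : iadj A z z.
Proof. by apply/iadjP; exists 1, 0; rewrite mulr1 addr0; split=> //; exact: smem0. Qed.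

Lemma iadj_min A B z : ideal_sub A B -> B z -> ideal_sub (iadj A z) B.
Proof.
move=> AB Bz _ /iadjP[t [a [Aa ->]]].
by apply: smemD; [exact: ideal_mulr | exact: AB].
Qed.

Definition annihilator (V : lmodType T) (z : V) : ideal T.
Proof.
apply: (@mkideal (fun r => r *: z = 0)).
- exact: scale0r.
- by move=> x y xz yz; rewrite scalerDl xz yz addr0.
- by move=> t x xz; rewrite -scalerA xz scaler0.
Defined.

Lemma ideal_gen_sub (G : T -> Prop) A : (forall s, G s -> A s) -> ideal_sub (ideal_gen G) A.
Proof. by move=> GA r; apply. Qed.

Lemma ideal_gen1P x r : ideal_gen (fun s => s = x) r -> exists h, r = x * h.
Proof.
suff gx : ideal_sub (ideal_gen (fun s => s = x)) (imul x whole) by move=> /gx[h _ ->]; exists h.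
by apply: ideal_gen_sub => _ ->; exists 1; rewrite ?mulr1.
Qed.

Lemma ideal_sub_trans A B C : ideal_sub A B -> ideal_sub B C -> ideal_sub A C.
Proof. by move=> AB BC r /AB/BC. Qed.

Lemma sub_whole A : ideal_sub A whole.
Proof. by []. Qed.

Lemma primeX P (hP : prime_id P) x k : P (x ^+ k) -> P x.
Proof.
case: hP => P1 hP; elim: k => [|k IH]; first by move/P1.
by rewrite exprS => /hP[].
Qed.

Lemma primeMr P (hP : prime_id P) x y : ~ P x -> P (x * y) -> P y.
Proof. by case: hP => _ hP nPx /hP[]. Qed.

Lemma prime1 P : prime_id P -> ~ P 1.
Proof. by case. Qed.

End IdealCalculus.

Definition zero_submod (R : comNzRingType) (V : lmodType R) : submod V.
Proof.
apply: (@Submod R V (fun z => z = 0)) => // [x y -> ->|a x ->]; first exact: addr0.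
exact: scaler0.
Defined.

(* A maximal product of the [g]s that moves [z] out of the submodule [A] is
   sent into [A] by every [g]. *)
Lemma socle_multiplier (R : comNzRingType) (V : lmodType R) (A : submod V)
    (good : R -> Prop) (z : V) (gs : seq R) :
    good 1 -> (forall a b, good a -> good b -> good (a * b)) ->
    (forall g, g \in gs -> good g) ->
    (forall g, g \in gs -> exists k, A (g ^+ k *: z)) -> ~ A z ->
  exists r, [/\ good r, ~ A (r *: z) & forall g, g \in gs -> A (g *: (r *: z))].
Proof.
move=> good1 goodM; elim: gs => [|g gs IH] ggood gnil nAz.
  by exists 1; rewrite scale1r; split.
have [|||r [gr nAr kr]] := IH => //.
- by move=> h hin; apply: ggood; rewrite inE hin orbT.
- by move=> h hin; apply: gnil; rewrite inE hin orbT.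
have exk : exists k, `[< A (g ^+ k *: (r *: z)) >].
  have [|k Ak] := gnil g; first by rewrite inE eqxx.
  by exists k; apply/asboolP; rewrite scalerA mulrC -scalerA; exact: smemZ.
have [[|k] /asboolP Ak kmin] := ex_minnP exk; first by rewrite expr0 scale1r in Ak.
exists (g ^+ k * r); split.
- apply: (goodM) => //; elim: k {Ak kmin} => [|k IHk]; first by rewrite expr0.
  by rewrite exprS; apply: (goodM) => //; apply: ggood; rewrite inE eqxx.
- by rewrite -scalerA => Ak'; have := kmin k (asboolT Ak'); rewrite ltnn.
- move=> h; rewrite inE => /orP[/eqP ->|hin]; first by rewrite !scalerA mulrA -exprS -scalerA.
  by rewrite -scalerA scalerA mulrC -scalerA; apply/smemZ/kr.
Qed.

Section Noetherian.
Variables (T : comNzRingType) (hN : noetherian T).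
Implicit Types (A B : ideal T).

Lemma ascending_stabilizes (F : nat -> ideal T) :
  (forall i, ideal_sub (F i) (F i.+1)) -> exists k, forall i, ideal_sub (F i) (F k).
Proof.
move=> Finc.
have Fmono i j : (i <= j)%N -> ideal_sub (F i) (F j).
  move=> /subnK <-; elim: (j - i)%N => [//|l IH] r Fr.
  by rewrite addSn; apply/Finc/IH.
have U0 : exists i, F i (0 : T) by exists 0%N; exact: smem0.
have UD (x y : T) : (exists i, F i x) -> (exists i, F i y) -> exists i, F i (x + y).
  move=> [i Fx] [j Fy]; exists (maxn i j); apply: smemD.
    by apply: Fmono Fx; exact: leq_maxl.
  by apply: Fmono Fy; exact: leq_maxr.
have UZ (a x : T) : (exists i, F i x) -> exists i, F i (a * x).
  by move=> [i Fx]; exists i; exact: ideal_mull.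
pose U : ideal T := @mkideal T (fun r => exists i, F i r) U0 UD UZ.
have [s Us] := hN U.
have [k Fk] : exists k, forall r, r \in s -> F k r.
  have : forall r, r \in s -> exists i, F i r.
    by move=> r rs; apply/Us => J; apply.
  elim: s {Us} => [|r s IH] Us; first by exists 0%N.
  have [|k Fk] := IH; first by move=> a ain; apply: Us; rewrite inE ain orbT.
  have [|j Fj] := Us r; first by rewrite inE eqxx.
  exists (maxn j k) => a; rewrite inE => /orP[/eqP ->|ain].
    by apply: Fmono Fj; exact: leq_maxl.
  by apply: Fmono (Fk a ain); exact: leq_maxr.
exists k => i r Fr.
have /Us Ur : U r by exists i.
exact: (Ur (F k) Fk).
Qed.

Lemma noetherian_ind (Phi : ideal T -> Prop) :
  (forall A, (forall B, ideal_sub A B -> ~ ideal_sub B A -> Phi B) -> Phi A) ->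
  forall A, Phi A.
Proof.
move=> step A; apply: contrapT => nA.
have next (X : {A : ideal T | ~ Phi A}) :
    {Y : {A : ideal T | ~ Phi A} |
       ideal_sub (sval X) (sval Y) /\ ~ ideal_sub (sval Y) (sval X)}.
  apply: cid; case: X => X nX /=; apply: contrapT => h; apply: nX; apply: step => B XB nBX.
  by apply: contrapT => nB; apply: h; exists (exist _ B nB).
pose F := fix F i := if i is j.+1 then sval (next (F j)) else exist (fun A => ~ Phi A) A nA.
have [|k hk] := @ascending_stabilizes (fun i => sval (F i)).
  by move=> i /=; case: (next (F i)) => Y [].
by have := hk k.+1; rewrite /=; case: (next (F k)) => Y [].
Qed.

Lemma exists_maximal_ideal_such_that (Phi : ideal T -> Prop) A : Phi A ->
  exists B, [/\ ideal_sub A B, Phi B &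
    forall C, ideal_sub B C -> Phi C -> ideal_sub C B].
Proof.
elim/noetherian_ind: A => A IH PA.
have [h|/existsNP[C /not_implyP[AC /not_implyP[PC nCA]]]] :=
  pselect (forall C, ideal_sub A C -> Phi C -> ideal_sub C A).
  exists A; split=> //; exact: (fun r => id).
have [B [CB PB Bmax]] := IH C AC nCA PC.
by exists B; split=> // r /AC/CB.
Qed.

(** An ideal maximal among those missing the multiplicative set of all [s * y ^+ k], with [s]
    outside [M], is prime. It is the trace of a prime of the localization at [M] with [y]
    inverted. *)
Lemma exists_prime_avoiding A (M : ideal T) y :
    prime_id M -> (forall s k, ~ M s -> ~ A (s * y ^+ k)) ->
  exists N, [/\ prime_id N, ideal_sub A N, ideal_sub N M & ~ N y].
Proof.
move=> [M1 Mp] hA.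
pose Phi (B : ideal T) := forall (s : T) k, ~ M s -> ~ B (s * y ^+ k).
have [N [AN hN' Nmax]] := @exists_maximal_ideal_such_that Phi A hA.
have meets a : ~ N a -> exists s k, ~ M s /\ iadj N a (s * y ^+ k).
  move=> nNa; apply: contrapT => h; apply: nNa.
  apply: (Nmax (iadj N a)); [exact: iadj_sub | | exact: iadj_mem].
  by move=> s k nMs Ns; apply: h; exists s, k.
exists N; split=> //.
- split=> [N1|a b Nab]; first by apply: (hN' 1 0%N) => //; rewrite expr0 mulr1.
  have [Na|nNa] := pselect (N a); first by left.
  right; apply: contrapT => nNb.
  have [s [k [nMs /iadjP[t [p [Np sE]]]]]] := meets a nNa.
  have [s' [k' [nMs' /iadjP[t' [p' [Np' sE']]]]]] := meets b nNb.
  apply: (hN' (s * s') (k + k')%N); first by move/Mp => [].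
  rewrite exprD mulrACA sE sE'.
  have -> : (a * t + p) * (b * t' + p') = t * t' * (a * b) + a * t * p' + (b * t' + p') * p by ring.
  by apply: smemD; [apply: smemD|]; apply: ideal_mull.
- move=> r Nr; apply: contrapT => nMr; apply: (hN' r 0%N) => //.
  by rewrite expr0 mulr1.
- by move=> Ny; apply: (hN' 1 1%N) => //; rewrite mul1r.
Qed.

End Noetherian.

(** * Localized length and Krull's principal ideal theorem *)

Section Length.
Variables (T : comNzRingType) (M : ideal T).
Hypothesis M_prime : prime_id M.
Implicit Types (A B C K P X Y : ideal T) (x y z r s t : T).

(* [B] is contained in [A] after localization at [M]. *)
Definition loc_sub A B := forall b, B b -> exists2 s, ~ M s & A (s * b).

(* There is a chain of ideals from [A] to [B] with [l] proper steps after
   localization at [M], i.e. the length of [(B/A)_M] is at least [l]. *)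
Fixpoint length_ge l A B : Prop :=
  if l is l'.+1 then
    exists C, [/\ ideal_sub C B, ~ loc_sub C B & length_ge l' A C]
  else ideal_sub A B.

Definition length_le A B u := forall l, length_ge l A B -> (l <= u)%N.

Lemma notMM s t : ~ M s -> ~ M t -> ~ M (s * t).
Proof. by case: M_prime => _ hM nMs nMt /hM[]. Qed.

Lemma sub_loc_sub A B : ideal_sub B A -> loc_sub A B.
Proof. by move=> BA b /BA Ab; exists 1; [exact: prime1 | rewrite mul1r]. Qed.

Lemma length_ge_sub l A B : length_ge l A B -> ideal_sub A B.
Proof. by elim: l B => [//|l IH] B [C [CB _ /IH AC]] r /AC/CB. Qed.

Lemma length_geSr l A B C : length_ge l A B -> ideal_sub B C -> length_ge l A C.
Proof.
case: l => [|l] /=; first by move=> AB BC r /AB/BC.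
move=> [D [DB nDB lAD]] BC; exists D; split=> // [r /DB/BC //|lDC].
by apply: nDB => b /BC/lDC.
Qed.

Lemma length_geSl l A A' B : length_ge l A' B -> ideal_sub A A' -> length_ge l A B.
Proof.
elim: l B => [|l IH] B /=; first by move=> AB AA r /AA/AB.
by move=> [C [CB nCB lAC]] AA; exists C; split=> //; apply: IH.
Qed.

Lemma length_geD k l A B C : length_ge k A B -> length_ge l B C -> length_ge (k + l) A C.
Proof.
move=> kAB; elim: l C => [|l IH] C /=; first by rewrite addn0; exact: length_geSr.
by rewrite addnS => -[D [DC nDC lBD]]; exists D; split=> //; exact: IH.
Qed.

Lemma length_ge_leq k l A B : (k <= l)%N -> length_ge l A B -> length_ge k A B.
Proof.
move=> /subnK <-; elim: (l - k)%N => [//|j IH]; rewrite addSn => -[C [CB _ lAC]].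
by apply: IH; exact: length_geSr lAC CB.
Qed.

(** This gives additivity of length. Intersect a chain with [B] and add [B] to it: by the modular
    law, a step that is proper after localization stays proper in at least one of the two chains. *)
Lemma length_ge_split l A B C : ideal_sub A B -> ideal_sub A C ->
    length_ge l A C ->
  exists i j, [/\ l = (i + j)%N, length_ge i A (icap C B) & length_ge j B (iadd C B)].
Proof.
move=> AB; elim: l C => [|l IH] C AC /=.
  move=> _; exists 0%N, 0%N; split=> //= r Hr; first by split; [exact: AC | exact: AB].
  by exists 0, r; split=> //; [exact: smem0 | rewrite add0r].
move=> [D [DC nDC lAD]].
have [i [j [lE iAD jBD]]] := IH D (length_ge_sub lAD) lAD.
have capDC : ideal_sub (icap D B) (icap C B) by move=> r [/DC Cr Br].
have addDC : ideal_sub (iadd D B) (iadd C B).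
  by move=> _ [a [b [/DC Ca Bb ->]]]; exists a, b.
have [capl|ncap] := pselect (loc_sub (icap D B) (icap C B)); last first.
  exists i.+1, j; rewrite lE addSn; split=> //; first by exists (icap D B).
  exact: length_geSr jBD addDC.
exists i, j.+1; rewrite lE addnS; split=> //; first exact: length_geSr iAD capDC.
exists (iadd D B); split=> // addl; apply: nDC => c Cc.
have [|s nMs [d [b [Dd Bb scE]]]] := addl c.
  by exists c, 0; split=> //; [exact: smem0 | rewrite addr0].
have [|s' nMs' [Ds'b _]] := capl b.
  split=> //; rewrite (_ : b = s * c - d); last by rewrite scE addrC addKr.
  by apply: idealB; [exact: ideal_mull | exact: DC].
exists (s' * s); first exact: notMM.
by rewrite -mulrA scE mulrDr; apply: smemD => //; exact: ideal_mull.
Qed.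

Lemma length_leD u v A B C : ideal_sub A B -> ideal_sub B C ->
  length_le A B u -> length_le B C v -> length_le A C (u + v).
Proof.
move=> AB BC Au Bv l lAC.
have [i [j [-> iAB jBC]]] := length_ge_split AB (ideal_sub_trans AB BC) lAC.
apply: leq_add; first by apply: Au; apply: length_geSr iAB _ => r [].
apply: Bv; apply: length_geSr jBC _ => _ [c [b [Cc /BC Cb ->]]].
exact: smemD.
Qed.

Lemma length_leSr u A B C : length_le A C u -> ideal_sub B C -> length_le A B u.
Proof. by move=> ACu BC l lAB; apply: ACu; exact: length_geSr lAB BC. Qed.

Lemma length_leSl u A B C : length_le A C u -> ideal_sub A B -> length_le B C u.
Proof. by move=> ACu AB l lBC; apply: ACu; exact: length_geSl lBC AB. Qed.

(** Since [X] contains [(K : z)], passing from ideals [Y] above [X] to [z Y + K] loses no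
    strictness. *)
Lemma length_ge_mul l z K X Y : (forall r, K (z * r) -> X r) ->
  length_ge l X Y -> length_ge l K (iadd (imul z Y) K).
Proof.
move=> KX; elim: l Y => [|l IH] Y /=.
  by move=> _ r Kr; exists 0, r; split; [exact: smem0 | | rewrite add0r].
move=> [C [CY nCY lXC]]; exists (iadd (imul z C) K); split; last exact: IH.
- by move=> _ [_ [a [[c /CY Yc ->] Ka ->]]]; exists (z * c), a; split=> //; exists c.
- move=> lzC; apply: nCY => y Yy.
  have [|s nMs [_ [a [[c Cc ->] Ka syE]]]] := lzC (z * y).
    by exists (z * y), 0; split; [exists y | exact: smem0 | rewrite addr0].
  exists s => //.
  have /(length_ge_sub lXC) Cy : X (s * y - c).
    by apply: KX; rewrite mulrBr mulrCA syE addrAC subrr add0r.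
  by rewrite -(subrK c (s * y)); exact: smemD.
Qed.

Lemma length_ge_colon l z K : length_ge l K (iadj K z) ->
  length_ge l (icolon K z) (whole T).
Proof.
move=> lK.
suff pull Y : ideal_sub Y (iadj K z) -> length_ge l K Y -> length_ge l (icolon K z) (icolon Y z).
  by apply: length_geSr (pull (iadj K z) _ lK) _.
elim: l Y {lK} => [|l IH] Y YK /=; first by move=> KY r /KY.
move=> [C [CY nCY lKC]]; exists (icolon C z); split.
- by move=> r /CY.
- move=> lC; apply: nCY => y Yy.
  have /iadjP[t [a [Ka yE]]] := YK y Yy.
  have Ca : C a by exact: length_ge_sub lKC a Ka.
  have [|s nMs Cst] := lC t.
    suff: Y (z * t) by [].
    by rewrite (_ : z * t = y - a); [apply: idealB => //; exact: CY | rewrite yE addrK].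
  exists s => //; rewrite yE mulrDr; apply: smemD; last exact: ideal_mull.
  by move: Cst; rewrite /= mulrCA.
- by apply: IH => // r /CY/YK.
Qed.

Lemma length_le_adj u z K X : (forall x, X x -> K (z * x)) ->
  length_le X (whole T) u -> length_le K (iadj K z) u.
Proof.
move=> XK Xu l /length_ge_colon lK; apply: Xu.
by apply: length_geSl lK _ => x /XK.
Qed.

Lemma length_le_field A : loc_sub A M -> length_le A (whole T) 1.
Proof.
move=> AM [|[|l]] // /(@length_ge_leq 2 l.+2 _ _ isT) [C [_ nC [D [DC nDC AD]]]].
exfalso; apply: nDC => c Cc.
have [Mc|nMc] := pselect (M c).
  by have [s nMs As] := AM c Mc; exists s => //; apply: AD.
exfalso; apply: nC => r _; exists c => //; exact: ideal_mulr.
Qed.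

(** Noetherian induction: unless [A] is everything locally, nilpotence of the elements of [M]
    provides a [t] outside [A] that [M] kills locally modulo [A], and adjoining it costs length at
    most 1. *)
Lemma finite_length A : noetherian T ->
    (forall g, M g -> exists s k, ~ M s /\ A (s * g ^+ k)) ->
  exists u, length_le A (whole T) u.
Proof.
move=> hN; have [gs Mgs] := hN M.
have Mg g : g \in gs -> M g by move=> gin; apply/Mgs => J; apply.
elim/(noetherian_ind hN): A => A IH Anil.
(* [satA] is the preimage of the localization of [A] at [M]. Powers of [g] lie in it, whereas in [A]
   they do so only up to a factor [s]. *)
pose satmem r := exists2 s, ~ M s & A (s * r).
have sat0 : satmem 0 by exists 1; [exact: prime1 | rewrite mulr0; exact: smem0].
have satD (x y : T) : satmem x -> satmem y -> satmem (x + y).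
  move=> [s nMs As] [t nMt At]; exists (s * t); first exact: notMM.
  rewrite mulrDr; apply: smemD; last by rewrite -mulrA; exact: ideal_mull.
  by rewrite mulrAC; exact: ideal_mulr.
have satZ (a x : T) : satmem x -> satmem (a * x).
  by move=> [s nMs As]; exists s => //; rewrite mulrCA; exact: ideal_mull.
pose satA : ideal T := @mkideal T satmem sat0 satD satZ.
have [[s nMs]|nsat] := pselect (satA 1).
  rewrite mulr1 => As; exists 0%N => -[//|l] /(@length_ge_leq 1 l.+1 _ _ isT) [C [_ nC AC]].
  by exfalso; apply: nC => r _; exists s => //; apply: ideal_mulr; exact: AC.
have [|||||t [_ nt kt]] := @socle_multiplier T T^o satA (fun _ => True) 1 gs => //.
  move=> g /Mg /Anil [s [k [nMs As]]]; exists k; exists s => //.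
  by rewrite -[_ *: _]/(_ * 1) mulr1.
have {nt} nt : ~ satA t by move: nt; rewrite -[_ *: _]/(_ * 1) mulr1.
have {kt} kt g : M g -> satA (g * t).
  move=> /Mgs Mg'; rewrite mulrC; apply: (Mg' (icolon satA t)) => h /kt.
  by rewrite -[_ *: _]/(_ * (_ * 1)) mulr1 mulrC.
have [|||u hu] := IH (iadj A t); first exact: iadj_sub.
- move=> sub; apply: nt; exists 1; first exact: prime1.
  by rewrite mul1r; apply: sub; exact: iadj_mem.
- by move=> g /Anil [s [k [nMs As]]]; exists s, k; split=> //; exact: iadj_sub.
exists (1 + u)%N; apply: length_leD hu => //; first exact: iadj_sub.
apply: (@length_le_adj _ _ _ (icolon A t)) => //.
apply: length_le_field => g /kt [s nMs As]; exists s => //.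
by rewrite /= mulrCA [t * g]mulrC.
Qed.

End Length.
Section PrincipalIdeal.
Variables (T : comNzRingType).
Hypothesis hN : noetherian T.
Implicit Types (A B P Q M : ideal T) (x y r s t : T).

Lemma length_max M A B u : ideal_sub A B -> length_le M A B u ->
  exists a, length_ge M a A B /\ length_le M A B a.
Proof.
move=> AB ABu.
have exl : exists l, `[< length_ge M l A B >] by exists 0%N; apply/asboolP.
have lu l : `[< length_ge M l A B >] -> (l <= u)%N by move/asboolP/ABu.
have [a /asboolP Aa amax] := ex_maxnP exl lu.
by exists a; split=> // l lAB; apply: amax; apply/asboolP.
Qed.

(* Kaplansky's argument: the hypothesis on [x] and [y] gives isomorphisms
   (x,y)/(x) = (x^2,xy)/(x^2) and R/(x) = (x^2,y)/(x^2,xy) in R = (T/P)_M, so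
   (x,y)/(x^2) and (x^2,y)/(x^2) have the same length. *)
Lemma kaplansky P M x y u : prime_id P -> prime_id M ->
    ideal_sub P M -> M x -> ~ P x -> ~ P y ->
    length_le M (iadj P x) (whole T) u ->
    (forall t, iadj P y (x * x * t) -> iadj P y (x * t)) ->
  exists2 s, ~ M s & iadj P y (x * s).
Proof.
move=> hP hM PM Mx nPx nPy lenu colon.
pose X := iadj P x; pose K := iadj P (x * x).
have KX : ideal_sub K X.
  by apply: iadj_min; [exact: iadj_sub | apply: ideal_mull; exact: iadj_mem].
have XK t : X t -> K (x * t).
  move=> /iadjP[g [p [Pp ->]]]; apply/iadjP; exists g, (x * p).
  by rewrite mulrDr mulrA; split=> //; exact: ideal_mull.
have KcX r : K (x * r) -> X r.
  move=> /iadjP[g [p [Pp xrE]]]; apply/iadjP; exists g, (r - x * g).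
  split; last by rewrite addrC subrK.
  by apply: (primeMr hP nPx); rewrite mulrBr xrE mulrA addrAC subrr add0r.
have [b [bX Xb]] := length_max (@sub_whole _ _) lenu.
have [a [aX Xa]] := length_max (@iadj_sub _ X y) (length_leSr lenu (@sub_whole _ _)).
pose B1 := iadd (imul x (iadj X y)) K.
have aB1 : length_ge M a K B1 by exact: length_ge_mul KcX aX.
(* The hypothesis [colon] enters here: modulo [B1], multiplication by [y] kills nothing outside
   [X]. *)
have B1cX r : B1 (y * r) -> X r.
  move=> [_ [k [[_ /iadjP[t [_ [/iadjP[t' [p [Pp ->]]] ->]]] ->] /iadjP[g [p' [Pp' ->]]] yrE]]].
  have xx : x * x * (t' + g) = y * (r - x * t) + - (x * p + p').
    by rewrite mulrBr yrE; ring.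
  have /colon/iadjP[c [p2 [Pp2 xcE]]] : iadj P y (x * x * (t' + g)).
    apply/iadjP; exists (r - x * t), (- (x * p + p')); split=> //.
    by apply: idealN; apply: smemD => //; exact: ideal_mull.
  apply/iadjP; exists (t + c), (r - x * (t + c)); split; last by ring.
  apply: (primeMr hP nPy).
  have -> : y * (r - x * (t + c)) = x * (x * (t' + g) - y * c) + (x * p + p').
    by rewrite !mulrBr yrE; ring.
  rewrite xcE addrAC subrr add0r.
  by apply: smemD; [exact: ideal_mull | apply: smemD => //; exact: ideal_mull].
have bB1 : length_ge M b B1 (iadj B1 y) by exact: length_ge_mul B1cX bX.
have B1sub : ideal_sub (iadj B1 y) (iadj K y).
  apply: iadj_min; last exact: iadj_mem.
  move=> _ [_ [k [[_ /iadjP[t [q [/XK Kq ->]]] ->] Kk ->]]].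
  apply/iadjP; exists (x * t), (x * q + k); split; last by ring.
  exact: smemD.
have lower := length_geSr (length_geD aB1 bB1) B1sub.
have KX' : ideal_sub (iadj K y) (iadj X y).
  by apply: iadj_min; [apply: ideal_sub_trans KX _; exact: iadj_sub | exact: iadj_mem].
have upper : length_le M K (iadj X y) (b + a).
  apply: (length_leD hM KX) => //; first exact: iadj_sub.
  apply: length_leSr (length_le_adj XK Xb) _.
  apply: iadj_min; last exact: iadj_mem.
  by move=> p Pp; apply: iadj_sub; exact: iadj_sub.
(* [K + (y)] already has length [a + b] over [K], the maximum for [X + (y)], so the two agree
   locally. *)
have /contrapT /(_ x) [|s nMs /iadjP[t [_ [/iadjP[g [p [Pp ->]]] sxE]]]] :
    ~ ~ loc_sub M (iadj K y) (iadj X y).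
  move=> nloc; have /upper : length_ge M (a + b).+1 K (iadj X y) by exists (iadj K y).
  by rewrite addnC ltnn.
  by apply: iadj_sub; exact: iadj_mem.
(* As [x] is in [M], this factor stays outside [M]: the Nakayama step. *)
exists (s - x * g).
  move=> Msx; apply: nMs; rewrite -(subrK (x * g) s).
  by apply: smemD => //; exact: ideal_mulr.
apply/iadjP; exists t, p; split=> //.
by rewrite mulrBr [x * s]mulrC sxE; ring.
Qed.

Lemma iadjX P x r k : iadj P x r -> iadj P (x ^+ k) (r ^+ k).
Proof.
move=> Pr; elim: k => [|k IH].
  by rewrite !expr0; apply: iadj_mem.
move: Pr IH => /iadjP[t [p [Pp rE]]] /iadjP[t' [p' [Pp' rkE]]].
apply/iadjP; exists (t * t'), (r * p' + x ^+ k * t' * p); split.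
  by apply: smemD; exact: ideal_mull.
rewrite !exprS rkE rE; ring.
Qed.

(** If no such [N] exists, [M] is minimal over [P + (x)], so the quotient by [P] and any power of
    [x] has finite localized length. For [y] in [Q] outside [P], [kaplansky] puts a power of [x],
    times an element outside [M], into [P + (y)]. Hence [x] is in [Q], and [Q] itself is an [N]. *)
Lemma krull_principal_ideal P Q M x :
    prime_id P -> prime_id Q -> prime_id M -> ideal_sub P Q -> ~ ideal_sub Q P ->
    ideal_sub Q M -> ~ ideal_sub M Q -> M x ->
  exists N, [/\ prime_id N, ideal_sub P N /\ ~ ideal_sub N P,
    ideal_sub N M /\ ~ ideal_sub M N & N x].
Proof.
move=> hP hQ hM PQ nQP QM nMQ Mx.
have [Qx|nQx] := pselect (Q x); first by exists Q.
have nPx : ~ P x by move/PQ.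
apply: contrapT => none.
have pow y : M y -> exists s k, ~ M s /\ iadj P x (s * y ^+ k).
  move=> My; apply: contrapT => nsk.
  have avoid (s : T) k : ~ M s -> ~ iadj P x (s * y ^+ k).
    by move=> nMs Ps; apply: nsk; exists s, k.
  have [N [hN' PN NM nNy]] := exists_prime_avoiding hN hM avoid.
  have Nx : N x by apply: PN; exact: iadj_mem.
  apply: none; exists N; split=> //; last by split=> // MN; apply: nNy; exact: MN.
  by split=> [|NP]; [apply: ideal_sub_trans PN; exact: iadj_sub | exact: nPx (NP x Nx)].
move/existsNP: (nQP) => [y /not_implyP[Qy nPy]].
(* Stationarity from [k] on makes [x ^+ k.+1] satisfy the colon hypothesis of [kaplansky]; the
   positive exponent keeps it in [M]. *)
have [|k hk] := ascending_stabilizes hN (F := fun i => icolon (iadj P y) (x ^+ i)).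
  move=> i r; change (iadj P y (x ^+ i * r) -> iadj P y (x ^+ i.+1 * r)).
  by rewrite exprS -mulrA; exact: ideal_mull.
have [u lenu] : exists u, length_le M (iadj P (x ^+ k.+1)) (whole T) u.
  apply: (finite_length hM hN) => g /pow [s [j [nMs /(@iadjX _ _ _ k.+1)]]].
  rewrite exprMn -exprM => h; exists (s ^+ k.+1), (j * k.+1)%N; split=> //.
  by move/(primeX hM).
have [|||||s nMs xs] := kaplansky (x := x ^+ k.+1) (y := y) hP hM _ _ _ _ lenu => //.
- by apply: ideal_sub_trans QM.
- by rewrite exprS; exact: ideal_mulr.
- by move/(primeX hP).
- move=> t; rewrite -exprD => /(hk _ t) h.
  by rewrite exprS -mulrA; apply: ideal_mull; exact: h.
apply: nQx; apply: (primeX hQ (k := k.+1)); apply: (primeMr hQ (x := s)); first by move/QM.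
rewrite mulrC; move: xs => /iadjP[t [p [Pp ->]]].
by apply: smemD; [exact: ideal_mulr | exact: PQ].
Qed.

(** * Chains of primes above prescribed elements *)

Fixpoint prime_chain_to (Z : T -> Prop) l M : Prop :=
  prime_id M /\ if l is l'.+1 then
    exists Q, [/\ ideal_sub Q M, ~ ideal_sub M Q & prime_chain_to Z l' Q]
  else forall z, Z z -> M z.

Lemma prime_chain_to_prime Z l M : prime_chain_to Z l M -> prime_id M.
Proof. by case: l => [|l] []. Qed.

Lemma prime_chain_to_sub Z l M M' : prime_id M' -> ideal_sub M M' ->
  prime_chain_to Z l M -> prime_chain_to Z l M'.
Proof.
case: l => [|l] hM' MM' [_ chain]; split=> //; first by move=> z /chain/MM'.
case: chain => Q [QM nMQ chain]; exists Q; split=> //; first exact: ideal_sub_trans MM'.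
by move=> M'Q; apply: nMQ; exact: ideal_sub_trans M'Q.
Qed.

(** One step of the chain is traded for [x]: replace the prime below [M] by one through [x], keep
    the rest, and continue downwards. At the bottom the last prime is dropped. *)
Lemma prime_chain_to_cons Z l M x : M x -> prime_chain_to Z l.+1 M ->
  prime_chain_to (fun z => z = x \/ Z z) l M.
Proof.
elim: l M => [|l IH] M Mx [hM [Q [QM nMQ chain]]].
  by split=> // z [->//|Zz]; apply: QM; case: chain => _; apply.
case: (chain) => hQ [Q' [Q'Q nQQ' chain']].
have [N [hN' [Q'N nNQ'] [NM nMN] Nx]] :=
  krull_principal_ideal (prime_chain_to_prime chain') hQ hM Q'Q nQQ' QM nMQ Mx.
by split=> //; exists N; split=> //; apply: IH => //; split=> //; exists Q'.
Qed.

Lemma prime_chain_to_seq l (cs : seq T) M : (forall c, c \in cs -> M c) ->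
  prime_chain_to (fun=> False) (l + size cs) M -> prime_chain_to (fun z => z \in cs) l M.
Proof.
have weaken (Z Z' : T -> Prop) : (forall z, Z' z -> Z z) ->
    forall k N, prime_chain_to Z k N -> prime_chain_to Z' k N.
  move=> ZZ; elim=> [|k IH] N [hN' chain]; split=> //; first by move=> z /ZZ/chain.
  by case: chain => Q [QN nNQ /IH chain]; exists Q.
elim: cs l => [|c cs IH] l csM /=; first by rewrite addn0; apply: weaken.
rewrite addnS -addSn => /IH chain.
have /prime_chain_to_cons -/(_ c) h : prime_chain_to (fun z => z \in cs) l.+1 M.
  by apply: chain => d din; apply: csM; rewrite inE din orbT.
apply: weaken (h _); last by apply: csM; rewrite inE eqxx.
by move=> z; rewrite inE => /orP[/eqP|]; [left|right].
Qed.

End PrincipalIdeal.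

Section LocalRing.
Variables (T : comNzRingType) (m : ideal T).
Hypotheses (hN : noetherian T) (hloc : is_local m).
Implicit Types (A N P Q : ideal T) (r x y : T).

Lemma local_unit r : ~ m r -> exists r' : T, r * r' = 1.
Proof.
move=> nmr; apply: contrapT => nunit; apply: nmr.
have [|N [rN Nproper Nmax]] :=
  @exists_maximal_ideal_such_that T hN (@proper_id T) (imul r (whole T)).
  by move=> [r' _ r'E]; apply: nunit; exists r'.
have /(hloc.2 N) Nm : maximal_id N by split=> // C Cp NC; exact: Nmax.
by apply/Nm/rN; exists 1; rewrite ?mulr1.
Qed.

Lemma local_prime : prime_id m.
Proof.
case: hloc => -[m1 _] _; split=> // a b mab.
have [ma|/local_unit [a' a1]] := pselect (m a); [by left | right].
by rewrite -[b]mul1r -a1 mulrAC; exact: ideal_mulr.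
Qed.

Lemma proper_sub_local A : proper_id A -> ideal_sub A m.
Proof.
move=> A1 r Ar; apply: contrapT => /local_unit [r' r1].
by apply: A1; rewrite -r1; exact: ideal_mulr.
Qed.

Lemma prime_chain_to_local d : krull_dim T d -> prime_chain_to (fun=> False) d m.
Proof.
move=> [[c [cprime cinc]] _].
apply: (@prime_chain_to_sub _ _ _ (c d)); first exact: local_prime.
  by apply: proper_sub_local; case: (cprime d (leqnn d)).
suff chain j : (j <= d)%N -> prime_chain_to (fun=> False) j (c j) by exact: chain.
elim: j => [|j IH] jd; first by split=> //; exact: cprime.
split; first exact: cprime.
have [cj ncj] := cinc j jd.
by exists (c j); split=> //; apply: IH; exact: ltnW.
Qed.

End LocalRing.

(** * Growth of the length of powers *)

Section Growth.
Variables (T : comNzRingType) (m P Q : ideal T) (c1 c2 : T).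
Hypotheses (hN : noetherian T) (hloc : is_local m).
Hypotheses (P_prime : prime_id P) (Q_prime : prime_id Q).
Hypotheses (PQ : ideal_sub P Q) (nQP : ~ ideal_sub Q P).
Hypotheses (Qm : ideal_sub Q m) (nmQ : ~ ideal_sub m Q).
Hypotheses (mc1 : m c1) (mc2 : m c2).
Hypothesis m_rad : forall r, m r -> exists k, iadj (iadj P c1) c2 (r ^+ k).
Implicit Types (A : ideal T) (x y r t : T).

Let m_prime : prime_id m := local_prime hN hloc.

(** Otherwise every prime over [P + (x)] would contain [y], hence [m], whereas Krull's theorem, with
    [Q] in between, yields one strictly inside [m]. *)
Lemma no_power_in_ideal x y : m x ->
  (forall r, m r -> exists k, iadj (iadj P x) y (r ^+ k)) -> forall i, ~ iadj P x (y ^+ i).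
Proof.
move=> mx rad i Pyi.
have [N [hN' [PN _] [Nm nmN] Nx]] :=
  krull_principal_ideal hN P_prime Q_prime m_prime PQ nQP Qm nmQ mx.
have PxN : ideal_sub (iadj P x) N by exact: iadj_min.
apply: nmN => r /rad [k rk]; apply: (primeX hN' (k := k)).
by apply: iadj_min rk => //; apply: (primeX hN' (k := i)); exact: PxN.
Qed.

Lemma c1_pow_notin i : ~ iadj P c2 (c1 ^+ i).
Proof.
apply: no_power_in_ideal => // r /m_rad [k rk]; exists k.
apply: iadj_min rk; last by apply: iadj_sub; exact: iadj_mem.
apply: iadj_min; last exact: iadj_mem.
by move=> p Pp; do 2!apply: iadj_sub.
Qed.

Lemma c2_notin : ~ P c2.
Proof.
move=> Pc2; have := no_power_in_ideal mc1 m_rad (i := 1%N).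
by rewrite expr1; apply; exact: iadj_sub.
Qed.

(* The ideal [(c1, c2)^s + P]. *)
Definition pw (s : nat) : ideal T.
Proof.
apply: (@mkideal T (fun r => exists (g : nat -> T) p,
  P p /\ r = \sum_(i < s.+1) c1 ^+ i * c2 ^+ (s - i) * g i + p)).
- exists (fun=> 0), 0; split; first exact: smem0.
  by rewrite addr0 big1 // => i _; rewrite mulr0.
- move=> _ _ [g [p [Pp ->]]] [g' [p' [Pp' ->]]].
  exists (fun i => g i + g' i), (p + p'); split; first exact: smemD.
  by rewrite addrACA -big_split; congr (_ + _); apply: eq_bigr => i _; rewrite mulrDr.
- move=> t _ [g [p [Pp ->]]]; exists (fun i => t * g i), (t * p); split; first exact: ideal_mull.
  by rewrite mulrDr mulr_sumr; congr (_ + _); apply: eq_bigr => i _; rewrite mulrCA.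
Defined.

Lemma sub_pw (s : nat) : ideal_sub P (pw s).
Proof.
move=> p Pp; exists (fun=> 0), p; split=> //.
by rewrite big1 ?add0r // => i _; rewrite mulr0.
Qed.

Lemma pw_monomial s a b : (s <= a + b)%N -> pw s (c1 ^+ a * c2 ^+ b).
Proof.
move=> sab; pose a' := minn a s.
have a's : (a' < s.+1)%N by rewrite ltnS geq_minr.
have [abE|] := boolP (s - a' <= b)%N; last by rewrite /a'; lia.
exists (fun i => if i == a' then c1 ^+ (a - a') * c2 ^+ (b - (s - a')) else 0), 0.
split; first exact: smem0.
rewrite addr0 (bigD1 (Ordinal a's)) //= eqxx big1 ?addr0 => [|i]; last first.
  by rewrite -val_eqE /= => /negbTE ->; rewrite mulr0.
by rewrite mulrACA -!exprD !subnKC // geq_minl.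
Qed.

Lemma pw_min s A : ideal_sub P A ->
  (forall i, (i <= s)%N -> A (c1 ^+ i * c2 ^+ (s - i))) -> ideal_sub (pw s) A.
Proof.
move=> PA mon _ [g [p [/PA Ap ->]]]; apply: smemD => //.
by apply: ideal_sum => i _; apply: ideal_mulr; apply: mon; rewrite -ltnS.
Qed.

Lemma pw_decreasing s s' : (s <= s')%N -> ideal_sub (pw s') (pw s).
Proof.
move=> ss'; apply: pw_min; first exact: sub_pw.
by move=> i is'; apply: pw_monomial; rewrite subnKC.
Qed.

Lemma pw_mul s a b r : pw s r -> pw (s + (a + b)) (c1 ^+ a * c2 ^+ b * r).
Proof.
apply: (pw_min (A := icolon (pw (s + (a + b))) (c1 ^+ a * c2 ^+ b))).
  by move=> p Pp; apply: sub_pw; exact: ideal_mull.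
move=> i si; rewrite /smem /= -/(smem (pw _)) mulrACA -!exprD.
by apply: pw_monomial; lia.
Qed.

(* An Artin-Rees bound; [N] makes [((c2) + P : c1^i)] stationary. *)
Lemma pw_colon : exists N, forall s x, (N < s)%N -> pw s (c2 * x) -> pw (s - N.+1) x.
Proof.
have [|N hcol] := ascending_stabilizes hN (F := fun i => icolon (iadj P c2) (c1 ^+ i)).
  move=> i r; change (iadj P c2 (c1 ^+ i * r) -> iadj P c2 (c1 ^+ i.+1 * r)).
  by rewrite exprS -mulrA; exact: ideal_mull.
exists N => s x Ns [g [p [Pp c2xE]]].
pose w := \sum_(i < s) c1 ^+ i * c2 ^+ (s.-1 - i) * g i.
have sumE : \sum_(i < s.+1) c1 ^+ i * c2 ^+ (s - i) * g i = c2 * w + c1 ^+ s * g s.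
  rewrite big_ord_recr /= subnn expr0 mulr1 mulr_sumr; congr (_ + _).
  apply: eq_bigr => i _; rewrite !mulrA [c2 * _]mulrC; congr (_ * _).
  by rewrite -mulrA -exprS; congr (_ * _ ^+ _); have := ltn_ord i; lia.
(* Modulo [P] and [c2] the top term [c1 ^+ s * g s] vanishes, so by stationarity does
   [c1 ^+ N * g s]; this lets [c2] be cancelled from the whole sum. *)
have /(hcol s (g s))/iadjP[y [p' [Pp' gE]]] : icolon (iadj P c2) (c1 ^+ s) (g s).
  apply/iadjP; exists (x - w), (- p); split; first exact: idealN.
  by rewrite mulrBr c2xE sumE; ring.
have sE : s = (s - N + N)%N by lia.
have Pdiff : P (x - w - c1 ^+ (s - N) * y).
  apply: (primeMr P_prime c2_notin).
  have -> : c2 * (x - w - c1 ^+ (s - N) * y) = p + c1 ^+ (s - N) * p'.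
    rewrite !mulrBr c2xE sumE {1}sE exprD -mulrA gE; ring.
  by apply: smemD => //; exact: ideal_mull.
have -> : x = (x - w - c1 ^+ (s - N) * y) + (w + c1 ^+ (s - N) * y) by ring.
(* [w] has order only [s - 1]; the loss [N.+1] instead of [N] covers this when [N = 0]. *)
apply: smemD; first exact: sub_pw.
apply: smemD.
  apply: ideal_sum => i _; apply: ideal_mulr; apply: pw_monomial.
  by have := ltn_ord i; lia.
apply: ideal_mulr; rewrite -[c1 ^+ _]mulr1 -(expr0 c2).
by apply: pw_monomial; lia.
Qed.

Lemma length_ge_c1_pow s : length_ge m s (iadj (iadj P c2) (c1 ^+ s)) (whole T).
Proof.
have step j : ideal_sub (iadj (iadj P c2) (c1 ^+ j.+1)) (iadj (iadj P c2) (c1 ^+ j)).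
  apply: iadj_min; first exact: iadj_sub.
  by rewrite exprS; apply: ideal_mull; exact: iadj_mem.
elim: s => [//|s IH]; rewrite -add1n; apply: length_geD IH.
exists (iadj (iadj P c2) (c1 ^+ s.+1)); split=> //.
move=> /(_ (c1 ^+ s)) [|t nmt /iadjP[g [q [P2q tE]]]]; first exact: iadj_mem.
have [t' tt'] : exists t' : T, (t - c1 * g) * t' = 1.
  apply: (local_unit hN hloc) => mt; apply: nmt; rewrite -(subrK (c1 * g) t).
  by apply: smemD => //; exact: ideal_mulr.
apply: (@c1_pow_notin s).
have -> : c1 ^+ s = q * t'.
  rewrite -[LHS]mulr1 -tt' mulrA; congr (_ * _).
  by rewrite mulrBr [_ * t]mulrC tE exprS; ring.
exact: ideal_mulr.
Qed.

(** Let h(s) be the length of the quotient by [pw s]. For [s = N.+1 * q.+1], h(s) is at least h(s -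
    N.+1) + s: [pw_colon] bounds the part generated by [c2] from below, and the quotient by [P],
    [c2] and [c1 ^+ s] has length at least [s]. Summing over [q] gives at least half a square. *)
Lemma pw_quadratic : exists N, forall q, exists2 l,
  length_ge m l (pw (N.+1 * q)) (whole T) & (q * q <= l.*2)%N.
Proof.
have [N colon] := pw_colon; exists N; elim=> [|q [l lq ql]].
  by exists 0%N.
exists (l + N.+1 * q.+1)%N; last by rewrite -mul2n; nia.
apply: (@length_geD _ _ _ _ _ (iadj (pw (N.+1 * q.+1)) c2)).
  apply: length_ge_mul lq => r /colon h; apply: pw_decreasing (h _); last by nia.
  by rewrite mulnS addKn.
apply: length_geSl (length_ge_c1_pow _) _; apply: iadj_min; last first.
  by apply: iadj_sub; exact: iadj_mem.
apply: pw_min => [p Pp|i]; first by do 2!apply: iadj_sub.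
rewrite leq_eqVlt => /orP[/eqP ->|ilt].
  by rewrite subnn mulr1; exact: iadj_mem.
apply: iadj_sub; apply: ideal_mull; rewrite (_ : _ - i = (N.+1 * q.+1 - i).-1.+1)%N; last by lia.
by rewrite exprS; apply: ideal_mulr; exact: iadj_mem.
Qed.

Lemma pw1_finite : exists u, length_le m (pw 1) (whole T) u.
Proof.
apply: (finite_length m_prime hN) => r /m_rad [k rk]; exists 1, k.
split; [exact: prime1 | rewrite mul1r; apply: iadj_min rk].
  apply: iadj_min; first exact: sub_pw.
  by rewrite -[c1]expr1 -[_ ^+ 1]mulr1 -(expr0 c2); exact: pw_monomial.
by rewrite -[c2]expr1 -[_ ^+ 1]mul1r -(expr0 c1); exact: pw_monomial.
Qed.

Lemma pw_step v u s : length_le m (pw 1) (whole T) v -> length_le m (pw s) (whole T) u ->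
  length_le m (pw s.+1) (whole T) (v * s.+1 + u).
Proof.
move=> lv lu.
(* The monomials of degree [s] are adjoined one at a time; modulo [pw s.+1] each is killed by
   [pw 1], so it costs at most [v]. *)
pose D := fix D j := if j is i.+1 then iadj (D i) (c1 ^+ i * c2 ^+ (s - i)) else pw s.+1.
have pwD j : ideal_sub (pw s.+1) (D j).
  by elim: j => //= j IH; apply: ideal_sub_trans IH _; exact: iadj_sub.
have lD j : (j <= s.+1)%N -> length_le m (pw s.+1) (D j) (v * j).
  elim: j => [_|j IH js].
    rewrite muln0 => -[//|l] /(@length_ge_leq _ _ 1 l.+1 _ _ isT) [C [_ nC pC]].
    by exfalso; apply: nC; exact: (sub_loc_sub m_prime).
  rewrite mulnS addnC; apply: (length_leD m_prime (pwD j)) => /=; first exact: iadj_sub.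
    by apply: IH; exact: ltnW.
  apply: length_le_adj lv => x /(pw_mul j (s - j)) px; apply: pwD.
  by move: px; rewrite subnKC.
apply: (length_leD m_prime _ (@sub_whole _ _) _ lu); first exact: pw_decreasing.
apply: length_leSr (lD _ (leqnn _)) _; apply: pw_min => [p Pp|i].
  by apply: pwD; exact: sub_pw.
rewrite -ltnS; elim: (s.+1) => // j IH; rewrite ltnS leq_eqVlt => /orP[/eqP ->|/IH h].
  exact: iadj_mem.
exact: iadj_sub.
Qed.

Lemma pw_steps v u s k : length_le m (pw 1) (whole T) v -> length_le m (pw s) (whole T) u ->
  length_le m (pw (s + k)) (whole T) (v * k * (s + k) + u).
Proof.
move=> lv lu; elim: k => [|k IH]; first by rewrite muln0 mul0n !addn0.
rewrite addnS => l /(pw_step lv IH); nia.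
Qed.

Lemma length_le_leq A u u' : (u <= u')%N ->
  length_le m A (whole T) u -> length_le m A (whole T) u'.
Proof. by move=> uu' h l /h lu; exact: leq_trans lu uu'. Qed.

(** The triangle of monomials of degree below [2s] consists of four triangles of size [s]. The
    translates by [c1 ^+ s] and [c2 ^+ s] cost [u] each. The other two form the quotient by [B]; the
    hypothesis puts [pw (s + k)] into [B], so together they cost [u] plus a term linear in [s].
    Hence the factor 3. *)
Lemma pw_double v u s k : (0 < s)%N ->
    (forall a b, (a + b = s + k)%N -> iadj (iadj P (c1 ^+ s)) (c2 ^+ s) (c1 ^+ a * c2 ^+ b)) ->
    length_le m (pw 1) (whole T) v -> length_le m (pw s) (whole T) u ->
  length_le m (pw s.*2) (whole T) (3 * u + v * k * k.+1 * s).
Proof.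
move=> s0 hk lv lu; have lsk := @pw_steps v u s k lv lu.
have [sk|ks] := leqP s k.
  apply: length_leSl (length_le_leq _ lsk) _; first by nia.
  by apply: pw_decreasing; lia.
have mul1 x : pw s x -> pw s.*2 (c1 ^+ s * x).
  by move=> /(pw_mul s 0); rewrite expr0 mulr1 addn0 addnn.
have mul2 x : pw s x -> iadj (pw s.*2) (c1 ^+ s) (c2 ^+ s * x).
  by move=> /(pw_mul 0 s); rewrite expr0 mul1r add0n addnn => h; exact: iadj_sub.
pose B := iadj (iadj (pw s.*2) (c1 ^+ s)) (c2 ^+ s).
have lB : length_le m (pw s.*2) B (u + u).
  apply: (length_leD m_prime (@iadj_sub _ _ _)); first exact: iadj_sub.
    exact: length_le_adj mul1 lu.
  exact: length_le_adj mul2 lu.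
have pwB : ideal_sub (pw (s + k)) B.
  apply: pw_min => [p Pp|i isk]; first by do 2!apply: iadj_sub; exact: sub_pw.
  have /hk : (i + (s + k - i) = s + k)%N by rewrite subnKC.
  apply: iadj_min; last exact: iadj_mem.
  apply: ideal_sub_trans (@iadj_sub _ _ _); apply: iadj_min; last exact: iadj_mem.
  by apply: ideal_sub_trans (@iadj_sub _ _ _); exact: sub_pw.
apply: (@length_le_leq _ (u + u + (v * k * (s + k) + u))); first by nia.
apply: (length_leD m_prime _ (@sub_whole _ _) (length_leSr lB pwB) lsk).
by apply: pw_decreasing; lia.
Qed.

Lemma exp4_dominates B : exists j, (B * 3 ^ j < 4 ^ j)%N.
Proof.
(* Bernoulli's inequality for [(1 + 1/3) ^ j], with denominators cleared. *)
have lower j : ((3 + j) * 3 ^ j <= 3 * 4 ^ j)%N.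
  by elim: j => // j IH; rewrite !expnS; nia.
exists (3 * B)%N; have := lower (3 * B)%N; have : (0 < 3 ^ (3 * B))%N by rewrite expn_gt0.
nia.
Qed.

(* With h(s) the length of the quotient by [pw s], [pw_double] gives
   h(2s) <= 3 h(s) + O(s), so h(2^j) = O(3^j), whereas h grows quadratically. *)
Theorem monomials_not_in_powers k : exists s a b, [/\ (0 < s)%N, (a + b = s + k)%N &
  ~ iadj (iadj P (c1 ^+ s)) (c2 ^+ s) (c1 ^+ a * c2 ^+ b)].
Proof.
apply: contrapT => none.
have hk s a b : (0 < s)%N -> (a + b = s + k)%N ->
    iadj (iadj P (c1 ^+ s)) (c2 ^+ s) (c1 ^+ a * c2 ^+ b).
  by move=> s0 abs; apply: contrapT => h; apply: none; exists s, a, b.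
have [v lv] := pw1_finite; pose C := (v * k * k.+1)%N.
(* The summand [C * 2 ^ j] absorbs the linear error: the recursion multiplies the whole left side by
   3. *)
have upper j : exists2 u, length_le m (pw (2 ^ j)) (whole T) u &
    (u + C * 2 ^ j <= (v + C) * 3 ^ j)%N.
  elim: j => [|j [u lu uj]]; first by exists v; rewrite ?muln1.
  exists (3 * u + C * 2 ^ j)%N; last by rewrite !expnS; nia.
  rewrite expnS mul2n; apply: pw_double lv lu; first by rewrite expn_gt0.
  by move=> a b; apply: hk; rewrite expn_gt0.
(* At [2 ^ (N.+1 + j)], which is at least [N.+1 * 2 ^ j], the lower bound is [4 ^ j / 2] and the
   upper one a constant times [3 ^ j]. *)
have [N quad] := pw_quadratic.
have [j hj] := exp4_dominates ((v + C) * 3 ^ N.+1).*2.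
have [l /(length_geSl)/(_ _)] := quad (2 ^ j)%N.
have [u lu uj] := upper (N.+1 + j)%N => lower lj.
have /lu : length_ge m l (pw (2 ^ (N.+1 + j))) (whole T).
  apply: lower; apply: pw_decreasing; rewrite expnD leq_mul2r.
  by apply/orP; right; apply: ltnW; exact: ltn_expl.
move: lj uj hj; rewrite !expnD -expnMn.
have -> : (4 = 2 * 2)%N by []. rewrite expnMn; nia.
Qed.

End Growth.

Lemma sop_monomials (T : comNzRingType) (m : ideal T) (c1 c2 : T) (cs : seq T) :
    noetherian T -> is_local m -> system_of_parameters m [:: c1, c2 & cs] ->
  exists P : ideal T, [/\ prime_id P, forall c, c \in cs -> P c &
    forall k, exists s a b, [/\ (0 < s)%N, (a + b = s + k)%N &
      ~ iadj (iadj P (c1 ^+ s)) (c2 ^+ s) (c1 ^+ a * c2 ^+ b)]].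
Proof.
move=> hN hloc [hdim [_ mrad]].
have mc c : c \in [:: c1, c2 & cs] -> m c.
  by move=> cin; apply/mrad; exists 1%N => J; rewrite expr1; apply.
have [||_ [Q [Qm nmQ [hQ [P [PQ nQP [hP Pcs]]]]]]] :=
    @prime_chain_to_seq T hN 2 cs m; last 1 first.
- exists P; split=> // k.
  apply: (@monomials_not_in_powers T m P Q) => //.
  + by apply: mc; rewrite inE eqxx.
  + by apply: mc; rewrite !inE eqxx orbT.
  + move=> r /mrad [j rj]; exists j; apply: rj => c.
    rewrite !inE => /or3P[/eqP ->|/eqP ->|/Pcs Pc].
    * by apply: iadj_sub; exact: iadj_mem.
    * exact: iadj_mem.
    * by do 2!apply: iadj_sub.
- by move=> c cin; apply: mc; rewrite !inE cin !orbT.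
- exact: prime_chain_to_local.
Qed.

(** * Local cohomology as a module of fractions *)

Section QuotientLift.
Variables (R : comNzRingType) (V W : lmodType R) (N : submod V) (f : {linear V -> W}).
Hypothesis fN : forall v, N v -> f v = 0.

Definition quotm_lift (z : quotm N) : W := f (repr z).

Lemma quotm_lift_pi v : quotm_lift (quotm_pi N v) = f v.
Proof. by apply/eqP; rewrite -subr_eq0 -linearB fN //; exact: quotm_pi_repr. Qed.

Lemma quotm_lift_linear : linear quotm_lift.
Proof.
move=> a; elim/quotm_ind=> v; elim/quotm_ind=> w.
have -> : a *: quotm_pi N v + quotm_pi N w = quotm_pi N (a *: v + w).
  by rewrite quotm_piD quotm_piZ.
by rewrite !quotm_lift_pi linearP.
Qed.

HB.instance Definition _ := GRing.isLinear.Build R (quotm N) W _ quotm_lift quotm_lift_linear.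

Definition quotm_lift_fun : {linear quotm N -> W} := quotm_lift.

Lemma quotm_lift_funE v : quotm_lift_fun (quotm_pi N v) = f v.
Proof. exact: quotm_lift_pi. Qed.

End QuotientLift.

Section Orbit.
Variables (R : comNzRingType) (V : lmodType R) (v : V).

Definition orbit_map (r : R^o) : V := (r : R) *: v.

Lemma orbit_map_linear : linear orbit_map.
Proof. by move=> a r s; rewrite /orbit_map scalerDl scalerA. Qed.

HB.instance Definition _ := GRing.isLinear.Build R R^o V _ orbit_map orbit_map_linear.

End Orbit.

(* Extend [r |-> r z] along the injection [y : R/A -> R/A]. *)
Lemma injective_divisible (R : comNzRingType) (E : lmodType R) (A : ideal R) (y : R) (z : E) :
    injective_module E -> (forall r : R, A (y * r) -> A r) ->
    (forall a : R, A a -> a *: z = 0) ->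
  exists2 e : E, forall a : R, A a -> a *: e = 0 & y *: e = z.
Proof.
move=> hE yreg Az.
pose one := quotm_pi A 1.
have pi1 (a : R) : a *: one = quotm_pi A a by rewrite -[a in RHS]mulr1 [RHS]quotm_piZ.
have Aone (a : R) : A a -> a *: one = 0.
  by move=> Aa; rewrite pi1; apply/quotm_piP; rewrite subr0.
have Ay (a : R) : A a -> orbit_map (y *: one) a = 0.
  by move=> Aa; rewrite /orbit_map scalerA mulrC -scalerA Aone ?scaler0.
pose u := @quotm_lift_fun R R^o (quotm A) A (orbit_map (y *: one)) Ay.
pose g := @quotm_lift_fun R R^o E A (orbit_map z) Az.
have uinj : injective u.
  elim/quotm_ind=> r; elim/quotm_ind=> s.
  rewrite /u !quotm_lift_funE /= /orbit_map !scalerA !pi1 => /quotm_piP.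
  rewrite -mulrBl mulrC => /yreg Ars; exact/quotm_piP.
have [h hu] := hE _ _ u g uinj; exists (h one).
  by move=> a Aa; rewrite -linearZ /= Aone ?linear0.
have uE : u one = y *: one.
  by rewrite {1}/one /u quotm_lift_funE; exact: scale1r.
have gE : g one = z by rewrite {1}/one /g quotm_lift_funE; exact: scale1r.
by rewrite -gE -hu uE linearZ.
Qed.

Section Staircase.
Variables (R : comNzRingType) (x : nat -> R) (n : nat).

Definition killed (V : lmodType R) t k (z : V) := forall i, (i < k)%N -> x i ^+ t *: z = 0.

Definition power_ideal (t k : nat) : ideal R.
Proof.
apply: (@mkideal R (fun r => exists g : nat -> R, r = \sum_(i < k) x i ^+ t * g i)).
- by exists (fun=> 0); rewrite big1 // => j _; rewrite mulr0.
- move=> _ _ [g ->] [g' ->]; exists (fun j => g j + g' j).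
  by rewrite -big_split; apply: eq_bigr => j _; rewrite mulrDr.
- move=> a _ [g ->]; exists (fun j => a * g j).
  by rewrite mulr_sumr; apply: eq_bigr => j _; rewrite mulrCA.
Defined.

Hypothesis x_regular : forall t k (r : R) (g : nat -> R), (k < n)%N ->
  x k ^+ t * r = \sum_(i < k) x i ^+ t * g i ->
  exists g' : nat -> R, r = \sum_(i < k) x i ^+ t * g' i.

Variables (M : lmodType R) (E : injective_resolution M).

Lemma killedP (V : lmodType R) t k a (y z : V) :
  killed t k y -> killed t k z -> killed t k (a *: y + z).
Proof. by move=> ky kz i ik; rewrite scalerDr scalerA mulrC -scalerA ky ?kz ?scaler0 ?addr0. Qed.

Lemma killedB (V : lmodType R) t k (y z : V) : killed t k y -> killed t k z -> killed t k (y - z).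
Proof. by move=> ky kz; rewrite addrC -scaleN1r; exact: killedP. Qed.

Lemma killed0 (V : lmodType R) t k : killed t k (0 : V).
Proof. by move=> i _; rewrite scaler0. Qed.

Lemma killedZ (V : lmodType R) t k a (y : V) : killed t k y -> killed t k (a *: y).
Proof. by move=> ky; rewrite -[_ *: _]addr0; apply: killedP => //; exact: killed0. Qed.

Lemma killedS (V : lmodType R) t k (z : V) :
  killed t k z -> x k ^+ t *: z = 0 -> killed t k.+1 z.
Proof. by move=> kz xz i; rewrite ltnS leq_eqVlt => /orP[/eqP ->|/kz]. Qed.

Lemma killed_leq (V : lmodType R) t k k' (z : V) : (k <= k')%N -> killed t k' z -> killed t k z.
Proof. by move=> kk' kz i ik; apply: kz; exact: leq_trans kk'. Qed.

Lemma killed_addn (V : lmodType R) t s k (z : V) : killed t k z -> killed (t + s) k z.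
Proof. by move=> kz i ik; rewrite addnC exprD -scalerA kz ?scaler0. Qed.

Lemma killed_d t k i (y : ires E i) : killed t k y -> killed t k (ires_d E i y).
Proof. by move=> ky j jk; rewrite -linearZ /= ky ?linear0. Qed.

Lemma killed_divisible t k i (z : ires E i) : (k < n)%N -> killed t k z ->
  exists2 e, killed t k e & x k ^+ t *: e = z.
Proof.
move=> kn kz.
have [||e Ae xe] := @injective_divisible R _ (power_ideal t k) (x k ^+ t) z (@ires_inj _ _ E i).
- by move=> r [g]; exact: x_regular.
- move=> a [g ->]; rewrite scaler_suml big1 // => j _.
  by rewrite mulrC -scalerA kz ?scaler0.
exists e => // j jk; apply: Ae; exists (fun l => (l == j)%:R).
rewrite (bigD1 (Ordinal jk)) //= eqxx mulr1 big1 ?addr0 // => l.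
by rewrite -val_eqE /= => /negbTE ->; rewrite mulr0.
Qed.

Lemma d_aug mu : ires_d E 0 (ires_aug E mu) = 0.
Proof. by apply/ires_exact0; exists mu. Qed.

Lemma d_d i (y : ires E i) : ires_d E i.+1 (ires_d E i y) = 0.
Proof. by apply/ires_exact; exists y. Qed.

Definition killed_boundary t k i : ires E i -> Prop :=
  match i return ires E i -> Prop with
  | 0 => fun z => z = 0
  | j.+1 => fun z => exists2 y, killed t k y & z = ires_d E j y
  end.

Lemma killed_boundaryZ t k i a (z : ires E i) :
  killed_boundary t k z -> killed_boundary t k (a *: z).
Proof.
case: i z => [|i] z /=; first by move=> ->; rewrite scaler0.
by move=> [y ky ->]; exists (a *: y); [exact: killedZ | rewrite linearZ].
Qed.

Lemma killed_boundary_divisible t k i (v : ires E i) : (k < n)%N -> killed_boundary t k v ->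
  exists w, [/\ killed t k w, x k ^+ t *: w = v & ires_d E i w = 0].
Proof.
move=> kn; case: i v => [|i] v /=.
  by move=> ->; exists 0; split; [exact: killed0 | rewrite scaler0 | rewrite linear0].
move=> [y /(killed_divisible kn) [y' ky' <-] ->]; exists (ires_d E i y').
by split; [exact: killed_d | rewrite -linearZ | exact: d_d].
Qed.

(* The complex of elements killed by the first [k] powers [x i ^+ t] computes
   [Ext (R/(x_0^t,...,x_(k-1)^t), M)], which vanishes above degree [k]. *)
Lemma killed_exact t k i (z : ires E i.+1) : (k <= n)%N -> (k <= i)%N ->
  killed t k z -> ires_d E i.+1 z = 0 -> exists2 y, killed t k y & z = ires_d E i y.
Proof.
elim: k i z => [|k IH] i z kn ki kz dz.
  by have [y zE] := (ires_exact z).1 dz; exists y.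
case: i ki z kz dz => // i ki z kz dz.
have [e ke zE] := IH i.+1 z (ltnW kn) (ltnW ki) (killed_leq (leqnSn k) kz) dz.
have [||y' ky' xeE] := IH i (x k ^+ t *: e) (ltnW kn) ki.
- exact: killedZ.
- by rewrite linearZ /= -zE; exact: kz.
have [y ky yE] := killed_divisible kn ky'.
exists (e - ires_d E i y); last by rewrite linearB /= d_d subr0.
apply: killedS; first by apply: killedB => //; exact: killed_d.
by rewrite scalerBr xeE -linearZ /= yE subrr.
Qed.

(* [stair t k mu z]: zigzagging from [mu] through the iterated connecting maps
   of 0 -> C_(k+1) -> C_k -> C_k -> 0, where [C_k] is the complex of elements
   killed by the first [k] powers [x i ^+ t], leads to [z]. *)
Fixpoint stair t k (mu : M) : ires E k -> Prop :=
  match k return ires E k -> Prop with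
  | 0 => fun z => z = ires_aug E mu
  | k'.+1 => fun z => exists e : ires E k',
      [/\ killed t k' e, stair t mu (x k' ^+ t *: e) & z = ires_d E k' e]
  end.

Lemma stair_cocycle t k mu (z : ires E k) : stair t mu z -> killed t k z /\ ires_d E k z = 0.
Proof.
elim: k z => [|k IH] z /=; first by move=> ->; rewrite d_aug.
move=> [e [ke /IH [_ dxe] ->]]; split; last exact: d_d.
by apply: killedS; [exact: killed_d | rewrite -linearZ].
Qed.

Lemma stairP t k a mu nu (y z : ires E k) :
  stair t mu y -> stair t nu z -> stair t (a *: mu + nu) (a *: y + z).
Proof.
elim: k y z => [|k IH] y z /=; first by move=> -> ->; rewrite linearP.
move=> [e [ke se ->]] [f [kf sf ->]]; exists (a *: e + f); split.
- exact: killedP.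
- by rewrite scalerDr scalerA mulrC -scalerA; exact: IH.
- by rewrite linearP.
Qed.

Lemma stair0 t k : stair t 0 (0 : ires E k).
Proof.
elim: k => [|k IH] /=; first by rewrite linear0.
by exists 0; rewrite scaler0 linear0; split=> //; exact: killed0.
Qed.

Lemma stairZ t k a mu (z : ires E k) : stair t mu z -> stair t (a *: mu) (a *: z).
Proof.
move=> sz; rewrite -[a *: mu]addr0 -[a *: z]addr0.
by apply: stairP => //; exact: stair0.
Qed.

Lemma stairB t k mu nu (y z : ires E k) : stair t mu y -> stair t nu z -> stair t (mu - nu) (y - z).
Proof.
move=> sy sz; rewrite ![_ - _]addrC -!scaleN1r; exact: stairP.
Qed.

Lemma stair_total t k mu : (k <= n)%N -> exists z : ires E k, stair t mu z.
Proof.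
elim: k => [|k IH] kn; first by exists (ires_aug E mu).
have [z sz] := IH (ltnW kn); have [kz _] := stair_cocycle sz.
have [e ke eE] := killed_divisible kn kz.
by exists (ires_d E k e), e; rewrite eE.
Qed.

(** The connecting map from [H^k(C_k)] to [H^(k+1)(C_(k+1))] is onto because [H^(k+1)(C_k)] vanishes
    by [killed_exact]. *)
Lemma stair_onto t k (z : ires E k) : (k <= n)%N -> killed t k z -> ires_d E k z = 0 ->
  exists mu z', stair t mu z' /\ killed_boundary t k (z - z').
Proof.
elim: k z => [|k IH] z kn kz dz.
  have [mu zE] := (ires_exact0 z).1 dz; exists mu, z.
  by rewrite subrr.
have [e ke zE] := killed_exact (ltnW kn) (leqnn k) (killed_leq (leqnSn k) kz) dz.
have [||mu [z' [sz' /(killed_boundary_divisible kn) [w [kw wE dw]]]]] :=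
  IH (x k ^+ t *: e) (ltnW kn).
- exact: killedZ.
- by rewrite linearZ /= -zE; exact: kz.
exists mu, z; split; last by rewrite subrr; exists 0; [exact: killed0 | rewrite linear0].
exists (e - w); split; first exact: killedB.
- by rewrite scalerBr wE opprB addrC subrK.
- by rewrite linearB /= dw subr0.
Qed.

(** Two primitives [e] and [y] of [z] differ by a cocycle of [C_k], represented by some [nu];
    subtracting [x k ^+ t *: nu] from [mu] reduces to the previous stage. Thus [H^k(C_k)] is [M]
    modulo the first [k] powers. *)
Lemma stair_kernel t k mu (z : ires E k) : (k <= n)%N ->
    stair t mu z -> killed_boundary t k z ->
  exists g : nat -> M, mu = \sum_(i < k) x i ^+ t *: g i.
Proof.
elim: k mu z => [|k IH] mu z kn.
  move=> /= -> aug0; exists (fun=> 0); rewrite big_ord0.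
  by apply: (@ires_aug_inj _ _ E); rewrite aug0 linear0.
move=> [e [ke se zE]] [y ky dyE].
have [||nu [z' [sz' bz']]] := @stair_onto t k (e - y) (ltnW kn).
- by apply: killedB => //; exact: killed_leq ky.
- by rewrite linearB /= -zE dyE subrr.
have [||g gE] := IH (mu - x k ^+ t *: nu) (x k ^+ t *: e - x k ^+ t *: z') (ltnW kn).
- by apply: stairB => //; exact: stairZ.
- have -> : x k ^+ t *: e - x k ^+ t *: z' = x k ^+ t *: (e - y - z').
    by rewrite !scalerBr (ky k) ?subr0.
  exact: killed_boundaryZ.
exists (fun i => if i == k then nu else g i); rewrite big_ord_recr /= eqxx.
rewrite -[LHS](subrK (x k ^+ t *: nu)) gE; congr (_ + _); apply: eq_bigr => i _.
by rewrite ltn_eqF.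
Qed.

Lemma stair_zero t k (z : ires E k) : (k <= n)%N -> stair t 0 z -> killed_boundary t k z.
Proof.
elim: k z => [|k IH] z kn /=; first by move=> ->; rewrite linear0.
move=> [e [ke /(IH _ (ltnW kn)) /(killed_boundary_divisible kn) [w [kw wE dw]] ->]].
exists (e - w); last by rewrite linearB /= dw subr0.
by apply: killedS; [exact: killedB | rewrite scalerBr wE subrr].
Qed.

(** The same zigzag read at level [t + s]: the transition map of the direct system whose limit is
    local cohomology. *)
Lemma stair_addn t s k mu (z : ires E k) : stair t mu z ->
  stair (t + s) ((\prod_(i < k) x i) ^+ s *: mu) z.
Proof.
elim: k z => [|k IH] z /=; first by move=> ->; rewrite big_ord0 expr1n scale1r.
move=> [e [ke se ->]]; exists e; split=> //; first exact: killed_addn.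
rewrite big_ord_recr /= exprMn mulrC -scalerA addnC exprD -scalerA.
by apply: stairZ; rewrite addnC; exact: IH.
Qed.

Variable I : ideal R.
Hypothesis gammaP : forall (V : lmodType R) (z : V), gamma I V z <-> exists t, killed t n z.

Lemma killed_coboundary t k i (z : ires E i) : (n <= k)%N ->
  killed_boundary t k z -> coboundary_mem I z.
Proof.
case: i z => [//|i] z nk [y ky ->]; exists y => //.
by apply/gammaP; exists t; exact: killed_leq ky.
Qed.

Lemma coboundary_killed t i (z : ires E i) :
  coboundary_mem I z -> exists s, killed_boundary (t + s) n z.
Proof.
case: i z => [|i] z /=; first by move=> ->; exists 0%N.
move=> [y /gammaP [s ks] ->]; exists s; exists y => //.
by rewrite addnC; exact: killed_addn.
Qed.

Definition class i (z : ires E i) (zc : cocycle I E i z) : local_cohomology I E i :=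
  quotm_pi (coboundary I E i) (SubM (asboolT zc)).

Lemma class_eq i (y z : ires E i) yc zc :
  coboundary_mem I (y - z) -> @class i y yc = @class i z zc.
Proof. by move=> b; apply/quotm_piP. Qed.

Lemma stair_in_cocycle t mu (z : ires E n) : stair t mu z -> cocycle I E n z.
Proof. by move=> /stair_cocycle [kz dz]; split=> //; apply/gammaP; exists t. Qed.

Let rep t mu : {z : ires E n | stair t mu z} := cid (stair_total t mu (leqnn n)).

(* The class of [mu / (x_0 ... x_(n-1))^t]. *)
Definition fraction_class t mu : local_cohomology I E n :=
  class (stair_in_cocycle (svalP (rep t mu))).

Lemma fraction_classE t mu z (sz : stair t mu z) (zc : cocycle I E n z) :
  fraction_class t mu = class zc.
Proof.
apply: class_eq; apply: (@killed_coboundary t n) => //; apply: stair_zero => //.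
by rewrite -(subrr mu); apply: stairB => //; exact: svalP.
Qed.

Lemma fraction_class_linear t : linear (fraction_class t).
Proof.
move=> a mu nu.
have sy := svalP (rep t mu); have sz := svalP (rep t nu).
have s := stairP a sy sz.
rewrite (fraction_classE s (stair_in_cocycle s)).
pose cl t' mu' := SubM (asboolT (stair_in_cocycle (svalP (rep t' mu')))).
transitivity (quotm_pi (coboundary I E n) (a *: cl t mu + cl t nu)).
  by congr quotm_pi; apply: val_inj.
by rewrite quotm_piD quotm_piZ.
Qed.

Lemma fraction_class_onto h : exists t mu, h = fraction_class t mu.
Proof.
elim/quotm_ind: h => -[z zP]; have zc := asboolW zP; have [/gammaP [t kz] dz] := zc.
have [mu [z' [sz' bz']]] := stair_onto (leqnn n) kz dz.
exists t, mu; rewrite (fraction_classE sz' (stair_in_cocycle sz')).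
by apply/quotm_piP; exact: killed_coboundary bz'.
Qed.

Lemma fraction_class_addn t s mu :
  fraction_class (t + s) ((\prod_(i < n) x i) ^+ s *: mu) = fraction_class t mu.
Proof. exact: fraction_classE (stair_addn s (svalP (rep t mu))) _. Qed.

Lemma fraction_class_killed t mu : killed t n (fraction_class t mu).
Proof.
move=> i ik; rewrite [LHS](esym (quotm_piZ _ _ _)).
apply/quotm_piP; rewrite subr0.
have [kz _] := stair_cocycle (svalP (rep t mu)).
rewrite /coboundary /smem /= kz //; exact: (@coboundary0 R I M E n).
Qed.

Lemma fraction_class_eq0 t mu : fraction_class t mu = 0 ->
  exists s (g : nat -> M), (\prod_(i < n) x i) ^+ s *: mu = \sum_(i < n) x i ^+ (t + s) *: g i.
Proof.
move=> /quotm_piP; rewrite subr0 /smem /= => b.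
have [s bs] := coboundary_killed t b.
have [g gE] := stair_kernel (leqnn n) (stair_addn s (svalP (rep t mu))) bs.
by exists s, g.
Qed.

End Staircase.

(** * Monomial ideals and torsion over a polynomial ring *)

Section Monomials.
Variables (T : comNzRingType) (n : nat).
Local Notation R := {mpoly T[n]}.
Implicit Types (a b : 'X_{1..n}) (p q r : R).

Lemma mcoeffMX_notle p a k : ~~ (a <= k)%MM -> (p * 'X_[a])@_k = 0.
Proof.
move=> nak; rewrite (mpolyE p) mulr_suml raddf_sum /= big1 // => b _.
rewrite -scalerAl -mpolyXD mcoeffZ mcoeffX.
by case: eqP => [kE|_]; [rewrite -kE lem_addl in nak | rewrite mulr0].
Qed.

Lemma mpolyXU_exp (i : 'I_n) t : 'X_i ^+ t = 'X_[U_(i) *+ t] :> R.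
Proof. by rewrite mpolyXn. Qed.

Lemma lem_mulU (i : 'I_n) t a : (U_(i) *+ t <= a)%MM = (t <= a i)%N.
Proof.
apply/mnm_lepP/idP => [/(_ i)|ta j]; first by rewrite mulmnE mnm1E eqxx mul1n.
by rewrite mulmnE mnm1E; case: eqP => [<-|]; rewrite ?mul1n.
Qed.

Definition xvar (i : nat) : R := oapp (fun j : 'I_n => 'X_j) 0 (insub i).

Lemma xvarE (i : 'I_n) : xvar i = 'X_i.
Proof. by rewrite /xvar valK. Qed.

(** A monomial ideal contains a polynomial exactly when it contains its monomials; this test makes
    regularity of the powers immediate. *)
Lemma xvar_sumP t k r : (k <= n)%N ->
  (exists g : nat -> R, r = \sum_(i < k) xvar i ^+ t * g i) <->
  (forall a, (forall i : 'I_n, (i < k)%N -> (a i < t)%N) -> r@_a = 0).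
Proof.
move=> kn; split=> [[g ->] a ak|ra].
  rewrite raddf_sum /= big1 // => i _.
  rewrite -[i : nat]/(widen_ord kn i : nat) xvarE mpolyXU_exp mulrC mcoeffMX_notle //.
  by rewrite lem_mulU -ltnNge; apply: ak; exact: (ltn_ord i).
rewrite (mpolyE r) big_seq.
apply: (big_ind (fun p => exists g : nat -> R, p = \sum_(i < k) xvar i ^+ t * g i)).
- by exists (fun=> 0); rewrite big1 // => i _; rewrite mulr0.
- move=> _ _ [g ->] [h ->]; exists (fun i => g i + h i).
  by rewrite -big_split; apply: eq_bigr => i _; rewrite mulrDr.
move=> a; rewrite mcoeff_msupp => /eqP ra0.
have [i ik ti] : exists2 i : 'I_n, (i < k)%N & (t <= a i)%N.
  apply: contrapT => none; apply/ra0/ra => i ik; rewrite ltnNge; apply/negP => ti.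
  by apply: none; exists i.
exists (fun j : nat => if j == i :> nat then r@_a *: 'X_[a - U_(i) *+ t] else 0).
rewrite (bigD1 (Ordinal ik)) //= eqxx big1 => [|j]; last first.
  by rewrite -val_eqE /= => /negbTE ->; rewrite mulr0.
rewrite addr0 xvarE mpolyXU_exp -scalerAr -mpolyXD addmC submK //.
by rewrite lem_mulU.
Qed.

Lemma xvar_regular t k r (g : nat -> R) : (k < n)%N ->
  xvar k ^+ t * r = \sum_(i < k) xvar i ^+ t * g i ->
  exists g' : nat -> R, r = \sum_(i < k) xvar i ^+ t * g' i.
Proof.
move=> kn xr; apply/(xvar_sumP t r (ltnW kn)) => a ak.
rewrite -(mcoeffMX _ (U_(Ordinal kn) *+ t)) -mpolyXU_exp -xvarE mulrC.
apply: (xvar_sumP t (xvar k ^+ t * r) (ltnW kn)).1; first by exists g.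
move=> i ik; rewrite mnmDE mulmnE mnm1E -val_eqE /= gtn_eqF // mul0n.
exact: ak.
Qed.

Definition degree_ideal (N : nat) : ideal R :=
  ideal_gen (fun r => exists2 a, mdeg a = N & r = 'X_[a]).

Lemma irrelevant_pow_degree N : ideal_sub (ideal_pow (irrelevant_ideal T n) N) (degree_ideal N).
Proof.
apply: ideal_gen_sub => _ [a aI ->]; elim: N a aI => [|N IH] a aI.
  by rewrite big_ord0 => J; apply; exists 0%MM; rewrite ?mdeg0 ?mpolyX0.
rewrite big_ord_recl; move: (IH _ (fun i => aI (lift ord0 i))).
set r := \prod_(_ < _) _; move: (aI ord0) => a0I rN.
rewrite mulrC; apply: (ideal_gen_sub (A := icolon (degree_ideal N.+1) r)) a0I.
move=> _ [i ->]; rewrite /icolon /smem /= -/(smem (degree_ideal N.+1)) mulrC.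
apply: (ideal_gen_sub (A := icolon (degree_ideal N.+1) 'X_i)) rN.
move=> _ [b bN ->] J; apply; exists (U_(i) + b)%MM; last by rewrite mpolyXD.
by rewrite mdegD mdeg1 bN.
Qed.

Lemma large_mdeg a t : (n * t < mdeg a)%N -> exists i, (t <= a i)%N.
Proof.
move=> nta; apply: contrapT => none; move: nta; rewrite ltnNge mdegE => /negP; apply.
rewrite -[X in (_ <= X * _)%N]card_ord -sum_nat_const; apply: leq_sum => i _.
by rewrite leqNgt; apply/negP => ti; apply: none; exists i; exact: ltnW.
Qed.

Lemma irrelevant_gammaP (V : lmodType R) (z : V) :
  gamma (irrelevant_ideal T n) V z <-> exists t, killed xvar t n z.
Proof.
split=> [[t tz]|[t kz]].
  exists t => i ik; apply: tz; rewrite -[i]/(Ordinal ik : nat) xvarE => J; apply.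
  exists (fun=> 'X_(Ordinal ik)); last by rewrite prodr_const card_ord.
  by move=> _ J' ; apply; exists (Ordinal ik).
(* Pigeonhole: a monomial of degree above [n * t] is divisible by some ['X_i ^+ t]. *)
exists (n * t).+1 => r /irrelevant_pow_degree rN.
apply: (rN (annihilator z)) => _ [a aN ->]; rewrite /smem /=.
have [i ti] : exists i, (t <= a i)%N by apply: large_mdeg; rewrite aN.
rewrite -(submK (m := U_(i) *+ t) (m' := a)) ?lem_mulU // mpolyXD -mpolyXU_exp -xvarE.
by rewrite -scalerA kz ?scaler0.
Qed.

End Monomials.

(** * Inverse monomials and the socle *)

Section HomogeneousParts.
Variables (T : comNzRingType) (n : nat).
Implicit Types (p q : {mpoly T[n]}).

Lemma pihomogM k d p q : p \is k.-homog ->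
  pihomog mdeg (k + d) (p * q) = p * pihomog mdeg d q.
Proof.
move=> hp; rewrite (mpolyE q) mulr_sumr !raddf_sum /= mulr_sumr; apply: eq_bigr => b _.
rewrite -scalerAr !linearZ /= -scalerAr pihomogX; congr (_ *: _).
have hpb : p * 'X_[b] \is (k + mdeg b).-homog by rewrite dhomogM // dhomogX.
case: eqP => [<-|nbd]; first by rewrite pihomog_dE.
by rewrite mulr0 (pihomog_ne0 _ hpb) // eqn_add2l; apply/eqP.
Qed.

Lemma pihomogM_lt k d p q : p \is k.-homog -> (d < k)%N -> pihomog mdeg d (p * q) = 0.
Proof.
move=> hp da; rewrite (mpolyE q) mulr_sumr raddf_sum /= big1 // => b _.
have hpb : p * 'X_[b] \is (k + mdeg b).-homog by rewrite dhomogM // dhomogX.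
rewrite -scalerAr linearZ /= (pihomog_ne0 _ hpb) ?scaler0 //.
by rewrite gtn_eqF // ltn_addr.
Qed.

Lemma pihomog_factor k d p q : p \is k.-homog ->
  exists q', pihomog mdeg d (p * q) = p * q'.
Proof.
move=> hp; have [da|/subnKC <-] := ltnP d k; last first.
  by exists (pihomog mdeg (d - k) q); rewrite pihomogM.
by exists 0; rewrite (pihomogM_lt _ hp da) mulr0.
Qed.

Lemma mcoeff_mul_ideal (J : ideal T) p q :
  (forall a, J p@_a) -> forall a, J (p * q)@_a.
Proof.
move=> Jp a; rewrite mcoeffM; apply: ideal_sum => k _.
exact: (@ideal_mulr T J).
Qed.

End HomogeneousParts.

Section Generators.
Variables (T : comNzRingType) (n : nat) (f : {mpoly T[n]}).
Local Notation R := {mpoly T[n]}.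
Implicit Types (a b : 'X_{1..n}) (r : R).

Definition box (t : nat) : 'X_{1..n} := [multinom t | _ < n].

Lemma boxE t i : box t i = t.
Proof. exact: mnmE. Qed.

Lemma mdeg_box t : mdeg (box t) = (n * t)%N.
Proof.
rewrite mdegE (eq_bigr (fun=> t)) => [|i _]; last exact: boxE.
by rewrite sum_nat_const card_ord.
Qed.

Lemma box_homog t : ('X_[box t] : R) \is (n * t).-homog.
Proof. by rewrite dhomogX /= mdeg_box. Qed.

Lemma mnm_le_mdeg a i : (a i <= mdeg a)%N.
Proof. by rewrite mdegE (bigD1 i) //= leq_addr. Qed.

(* [u t] plays the role of the class of [1 / (x_1 ... x_n)^t]. *)
Variables (H : lmodType R) (u : nat -> H).
Hypothesis u_onto : forall h, exists t r, h = r *: u t.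
Hypothesis u_shift : forall t s, 'X_[box s] *: u (t + s) = u t.
Hypothesis u_killed : forall t (i : 'I_n), 'X_i ^+ t *: u t = 0.
Hypothesis u_f : forall t, f *: u t = 0.
(* The class of the monomial with exponents [- b i - 1]. *)
Definition psi b : H := 'X_[box (mdeg b) - b] *: u (mdeg b).+1.

Lemma f_kills (h : H) : f *: h = 0.
Proof. by have [t [r ->]] := u_onto h; rewrite scalerA mulrC -scalerA u_f scaler0. Qed.

Lemma u_monomial0 t a i : (t <= a i)%N -> 'X_[a] *: u t = 0.
Proof.
move=> ti; rewrite -(submK (m := U_(i) *+ t) (m' := a)) ?lem_mulU //.
by rewrite mpolyXD -mpolyXU_exp -scalerA u_killed scaler0.
Qed.

Lemma psiE t b : (forall i, b i <= t)%N -> 'X_[box t - b] *: u t.+1 = psi b.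
Proof.
move=> bt; rewrite /psi -(u_shift t.+1 (mdeg b)) -(u_shift (mdeg b).+1 t).
rewrite !scalerA -!mpolyXD addSn addnC -addSn; congr ('X_[_] *: _).
apply/mnmP => i; rewrite !mnmDE !mnmBE !boxE.
by have := bt i; have := mnm_le_mdeg b i; lia.
Qed.

Lemma u_monomial t a : (forall i, a i <= t)%N -> 'X_[a] *: u t.+1 = psi (box t - a).
Proof.
move=> at_; rewrite -(@psiE t) => [|i]; last by rewrite mnmBE boxE leq_subr.
congr ('X_[_] *: _); apply/mnmP => i; rewrite !mnmBE !boxE.
by have := at_ i; lia.
Qed.

Lemma X_psi a b : 'X_[a] *: psi b = if (a <= b)%MM then psi (b - a) else 0.
Proof.
rewrite /psi scalerA -mpolyXD; case: ifPn => [ab|].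
  rewrite -/(psi (b - a)) -(@psiE (mdeg b)) => [|i]; last first.
    by rewrite mnmBE; apply: leq_trans (leq_subr _ _) (mnm_le_mdeg _ _).
  congr ('X_[_] *: _); apply/mnmP => i; rewrite mnmDE !mnmBE !boxE.
  by have := mnm_lepP ab i; have := mnm_le_mdeg b i; lia.
rewrite negb_forall => /existsP[i]; rewrite -ltnNge => ba.
apply: (@u_monomial0 _ _ i); rewrite mnmDE mnmBE boxE.
by have := mnm_le_mdeg b i; lia.
Qed.

Lemma uE t r : r *: u t = \sum_(a <- msupp r) (r@_a)%:MP *: ('X_[a] *: u t).
Proof.
rewrite {1}(mpolyE r) scaler_suml; apply: eq_bigr => a _.
by rewrite -mul_mpolyC scalerA.
Qed.

Lemma u_onto_pos (h : H) : exists t r, h = r *: u t.+1.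
Proof.
have [t [r ->]] := u_onto h; exists t, (r * 'X_[box 1]).
by rewrite -scalerA -[in LHS](u_shift t 1) addn1.
Qed.

Lemma psi_span (N : submod H) : (forall b, N (psi b)) -> forall h, N h.
Proof.
move=> Npsi h; have [t [r ->]] := u_onto_pos h; rewrite uE.
apply: (big_ind (fun h => N h)) => [||a _]; [exact: smem0|exact: smemD|apply: smemZ].
have [at_|/existsNP[i /negP]] := pselect (forall i, a i <= t)%N.
  by rewrite u_monomial.
by rewrite -ltnNge => ta; rewrite (u_monomial0 ta); exact: smem0.
Qed.

Definition nilp (c : T) : submod H.
Proof.
apply: (@Submod _ H (fun h => exists k, (c ^+ k)%:MP *: h = 0)).
- by exists 0%N; rewrite scaler0.
- move=> x y [k kx] [l ly]; exists (k + l)%N; rewrite scalerDr exprD mpolyCM.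
  by rewrite mulrC -scalerA kx scaler0 mulrC -scalerA ly scaler0 addr0.
- move=> r x [k kx]; exists k.
  by rewrite scalerA mulrC -scalerA kx scaler0.
Defined.

Lemma nilp_uniform c D : (forall h, nilp c h) ->
  exists K, forall b, (mdeg b <= D)%N -> (c ^+ K)%:MP *: psi b = 0.
Proof.
move=> hc; have /fin_all_exists[K hK] (b : 'X_{1..n < D.+1}) : exists k, (c ^+ k)%:MP *: psi b = 0.
  exact: hc.
exists (\sum_b K b)%N => b bD; have bD' : (mdeg b < D.+1)%N by [].
rewrite (bigD1 (BMultinom bD')) //= addnC exprD mpolyCM -scalerA.
by rewrite (hK (BMultinom bD')) scaler0.
Qed.

(* [h] is homogeneous of degree [- de]. *)
Definition hdeg de (h : H) :=
  exists t d r, [/\ r \is d.-homog, (d + de = n * t.+1)%N & h = r *: u t.+1].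

Lemma hdeg_psi b : hdeg (n + mdeg b) (psi b).
Proof.
exists (mdeg b), (mdeg (box (mdeg b) - b)), 'X_[box (mdeg b) - b].
split=> //; first by rewrite dhomogX.
rewrite mulnS addnCA; congr (_ + _)%N; rewrite -mdegD submK ?mdeg_box //.
by apply/mnm_lepP => i; rewrite boxE mnm_le_mdeg.
Qed.

Lemma hdeg_mulC de h c : hdeg de h -> hdeg de (c%:MP *: h).
Proof.
move=> [t [d [r [hr dE ->]]]]; exists t, d, (c%:MP * r); split=> //; last by rewrite scalerA.
by rewrite mul_mpolyC dhomogZ.
Qed.

Lemma hdeg_mulX de h a : (mdeg a <= de)%N -> hdeg de h -> hdeg (de - mdeg a) ('X_[a] *: h).
Proof.
move=> ade [t [d [r [hr dE ->]]]]; exists t, (mdeg a + d)%N, ('X_[a] * r); split.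
- by rewrite dhomogM // dhomogX.
- by rewrite -dE; lia.
- by rewrite scalerA.
Qed.

Lemma hdeg_mulX0 de h a : (de < mdeg a)%N -> hdeg de h -> 'X_[a] *: h = 0.
Proof.
move=> dea [t [d [r [hr dE ->]]]]; rewrite uE scaler_sumr big_seq big1 // => b br.
rewrite scalerA mulrC -!scalerA [X in _ *: X]scalerA -mpolyXD.
have [i ti] : exists i, (t.+1 <= (a + b)%MM i)%N.
  by apply: large_mdeg; rewrite mdegD (dhomog_mf hr br) -dE; lia.
by rewrite (u_monomial0 ti) scaler0.
Qed.

Lemma hdeg_nilp c D : (forall h, nilp c h) ->
  exists K, forall de h, (de <= D)%N -> hdeg de h -> (c ^+ K)%:MP *: h = 0.
Proof.
move=> /(nilp_uniform D)[K hK]; exists K => de _ deD [t [d [r [hr dE ->]]]].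
rewrite uE scaler_sumr big_seq big1 // => a ar.
have ad : mdeg a = d by exact: (dhomog_mf hr ar).
rewrite scalerA mulrC -scalerA.
have [at_|/existsNP[i /negP]] := pselect (forall i, a i <= t)%N; last first.
  by rewrite -ltnNge => ta; rewrite (u_monomial0 ta) !scaler0.
rewrite u_monomial // hK ?scaler0 //.
have : (a <= box t)%MM by apply/mnm_lepP => i; rewrite boxE.
by move=> /submK /(congr1 (@mdeg n)); rewrite mdegD mdeg_box; lia.
Qed.

Definition const_annihilator (h : H) : ideal T.
Proof.
apply: (@mkideal T (fun c => c%:MP *: h = 0)).
- by rewrite mpolyC0 scale0r.
- by move=> x y xh yh; rewrite mpolyCD scalerDl xh yh addr0.
- by move=> x y yh; rewrite mpolyCM -scalerA yh scaler0.
Defined.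

Hypothesis u_ker : forall t r, r *: u t = 0 -> exists s (g : 'I_n -> R) h,
  'X_[box s] * r = \sum_(i < n) 'X_i ^+ (t + s) * g i + f * h.

(** The coefficient of [w] at [b] is its pairing with [psi b]. If [c] kills [psi b], a numerator is
    a combination of powers of variables and of [f]: the powers are invisible at [box (s + t)], one
    below their exponent, and [f * w] has coefficients in [J]. *)
Lemma mcoeff_psi_kernel (J : ideal T) (w : R) b (c : T) :
  (forall a, J (f * w)@_a) -> c%:MP *: psi b = 0 -> J (c * w@_b).
Proof.
move=> Jw; rewrite /psi scalerA => /u_ker[s [g [h E]]].
set t := mdeg b in E.
have bt : (b <= box t)%MM by apply/mnm_lepP => i; rewrite boxE mnm_le_mdeg.
have boxD : (b + (box s + (box t - b)))%MM = box (s + t).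
  apply/mnmP => i; rewrite !mnmDE mnmBE !boxE.
  by have := mnm_lepP bt i; rewrite boxE; lia.
have -> : c * w@_b = ('X_[box s] * (c%:MP * 'X_[box t - b]) * w)@_(box (s + t)).
  rewrite -mcoeffCM -(mcoeffMX _ (box s + (box t - b))) addmC boxD.
  by congr (_@__); rewrite mpolyXD; ring.
rewrite E mulrDl raddfD /= mulr_suml raddf_sum /= big1 ?add0r => [|i _].
  have -> : f * h * w = f * w * h by ring.
  exact: mcoeff_mul_ideal.
rewrite -mulrA mulrC mpolyXU_exp mcoeffMX_notle //.
by rewrite lem_mulU boxE; lia.
Qed.

Variable e : nat.
Hypothesis f_homog : f \is e.-homog.

Lemma mdeg_f a : a \in msupp f -> mdeg a = e.
Proof. exact: (dhomog_mf f_homog). Qed.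

(* Induction on [al]: modulo the coefficients below [al], which act nilpotently,
   the relation [f psi(b + al) = 0] expresses [f_al psi(b)] through smaller
   monomials of the same degree. *)
Lemma coef_nilp al : al \in msupp f -> forall h, nilp f@_al h.
Proof.
elim/(@ltmwf n): al => al IH alf; apply: psi_span => b0; apply: contrapT => nb0.
pose memA (t : T) := forall b, mdeg b = mdeg b0 -> nilp f@_al (t%:MP *: psi b).
have A0 : memA 0 by move=> b _; rewrite mpolyC0 scale0r; exact: smem0.
have AD (x y : T) : memA x -> memA y -> memA (x + y).
  by move=> Ax Ay b bE; rewrite mpolyCD scalerDl; apply: smemD; [exact: Ax|exact: Ay].
have AZ (x y : T) : memA y -> memA (x * y).
  by move=> Ay b bE; rewrite mpolyCM -scalerA; apply: smemZ; exact: Ay.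
pose A : ideal T := mkideal A0 AD AZ.
pose gs := [seq f@_a | a <- msupp f & (a < al)%O].
have [|||||t [_ nAt kt]] := @socle_multiplier T T^o A (fun=> True) 1 gs => //.
- move=> _ /mapP[a + ->]; rewrite mem_filter => /andP[aal af].
  have [K hK] := nilp_uniform (mdeg b0) (IH a aal af).
  exists K => b bE; rewrite -[_ *: 1]/(_ * 1) mulr1 hK ?bE //; exact: smem0.
- by move=> /(_ b0 erefl); rewrite mpolyC1 scale1r.
apply: nAt; rewrite -[_ *: 1]/(_ * 1) mulr1.
elim/(@ltmwf n) => b IHb bE.
suff [k hk] : nilp f@_al ((f@_al)%:MP *: (t%:MP *: psi b)).
  by exists k.+1; rewrite exprSr mpolyCM -scalerA.
(* Terms with [a < al] are nilpotent by the choice of [t]; for [a > al] the exponent [b + al - a] is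
   below [b], which is the inner induction. *)
have : t%:MP *: (f *: psi (b + al)) = 0 by rewrite f_kills scaler0.
rewrite {1}(mpolyE f) (bigD1_seq al) ?msupp_uniq //= scalerDl scalerDr.
rewrite -mul_mpolyC -scalerA X_psi lem_addl addmK scalerA mulrC -scalerA.
move=> /eqP; rewrite addr_eq0 => /eqP ->; apply: (@smemN _ _ (nilp f@_al)).
rewrite scaler_suml scaler_sumr big_seq_cond.
apply: (big_ind (fun h => nilp f@_al h)) => [||a /andP[af aal]]; [exact: smem0|exact: smemD|].
rewrite -mul_mpolyC -scalerA X_psi; case: ifP => [ab|_]; last by rewrite !scaler0; exact: smem0.
have degE : mdeg (b + al - a) = mdeg b0.
  have := congr1 (@mdeg n) (submK ab); rewrite !mdegD (mdeg_f af) (mdeg_f alf) -bE; lia.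
have [lta|] := boolP (a < al)%O.
  have /kt/(_ _ degE) : f@_a \in gs by apply/mapP; exists a; rewrite // mem_filter lta.
  by rewrite -[_ *: (_ *: 1)]/(_ * (_ * 1)) mulr1 mulrC mpolyCM -scalerA.
rewrite -leNgt le_eqVlt eq_sym (negbTE aal) /= => lta.
rewrite scalerA mulrC -scalerA; apply: (@smemZ _ _ (nilp f@_al)); apply: IHb => //.
by rewrite -(@ltmc_add2l n _ _ a) submK // ltmc_add2r.
Qed.

Lemma u_homog t d r : r *: u t = 0 -> pihomog mdeg d r *: u t = 0.
Proof.
move=> /u_ker[s [g [h hE]]].
have hbox := box_homog s.
have /fin_all_exists[g' g'E] (i : 'I_n) :
    exists g', pihomog mdeg (n * s + d) ('X_i ^+ (t + s) * g i) = 'X_i ^+ (t + s) * g'.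
  by apply: (@pihomog_factor _ _ (t + s)%N); rewrite mpolyXU_exp dhomogX /= mdegMn mdeg1 mul1n.
have [h' h'E] := pihomog_factor (n * s + d) h f_homog.
have : 'X_[box s] * pihomog mdeg d r = \sum_(i < n) 'X_i ^+ (t + s) * g' i + f * h'.
  rewrite -(pihomogM _ _ hbox) hE raddfD raddf_sum /= h'E; congr (_ + _).
  by apply: eq_bigr => i _.
move=> E; rewrite -(u_shift t s) scalerA mulrC E scalerDl scaler_suml.
rewrite big1 ?add0r => [|i _]; first by rewrite mulrC -scalerA u_f scaler0.
by rewrite mulrC -scalerA u_killed scaler0.
Qed.

(** A fraction over [(x_1 ... x_n)^t] has no part of degree below [- n * t]: compare the two
    presentations of [h] in numerator degree [n * t + d], where the contribution of [r] vanishes. *)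
Lemma hdeg_bounded t de h r : h = r *: u t -> hdeg de h -> (n * t < de)%N -> h = 0.
Proof.
move=> hE [t' [d [r' [hr' dE hE']]]] nt; rewrite hE'.
have hbox := box_homog.
have : ('X_[box t] * r' - 'X_[box t'.+1] * r) *: u (t'.+1 + t) = 0.
  rewrite scalerBl mulrC -scalerA u_shift -hE' mulrC -scalerA addnC u_shift -hE.
  exact: subrr.
move=> /(u_homog (n * t + d)); rewrite raddfB /= (pihomogM _ _ (hbox _)).
rewrite (pihomogM_lt _ (hbox _)); last by lia.
by rewrite subr0 pihomog_dE // mulrC -scalerA u_shift.
Qed.

Lemma hdeg_killed (m : ideal T) (c1 c2 : T) (t0 : nat) : noetherian T ->
    (forall c : T, m c -> exists k, ideal_gen (fun c => c \in nonzero_coeffs f) (c ^+ k)) ->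
    c1 \in nonzero_coeffs f -> c2 \in nonzero_coeffs f ->
    (forall z : H, socle_mem (homog_max_ideal n m) z -> exists r, z = r *: u t0) ->
  exists k, forall de h i j, hdeg de h -> (k <= i + j)%N -> (c1 ^+ i * c2 ^+ j)%:MP *: h = 0.
Proof.
move=> hN mrad c1f c2f fin.
have cnilp c : c \in nonzero_coeffs f -> forall h, nilp c h.
  by move=> /mapP[al alf ->]; exact: coef_nilp.
have [K1 hK1] := hdeg_nilp (n * t0) (cnilp c1 c1f).
have [K2 hK2] := hdeg_nilp (n * t0) (cnilp c2 c2f).
exists (K1 + K2)%N => de h i j hh kij; set C := (_ * _)%:MP.
have small de' h' : (de' <= n * t0)%N -> hdeg de' h' -> C *: h' = 0.
  move=> le hh'; have [K1i|iK1] := leqP K1 i.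
    by rewrite /C -(subnK K1i) exprD -mulrA mulrCA mpolyCM mulrC -scalerA
       (hK1 _ _ le hh') scaler0.
  have K2j : (K2 <= j)%N by lia.
  by rewrite /C -(subnK K2j) exprD mulrA mpolyCM -scalerA (hK2 _ _ le hh') scaler0.
(* Multipliers are single terms, so that homogeneity of [h] survives. *)
pose good (r : R) := exists c a, r = c%:MP * 'X_[a].
have good1 : good 1 by exists 1, 0%MM; rewrite mpolyX0 mulr1 mpolyC1.
have goodC c : good c%:MP by exists c, 0%MM; rewrite mpolyX0 mulr1.
have goodM r s : good r -> good s -> good (r * s).
  move=> [c [a ->]] [c' [a' ->]]; exists (c * c'), (a + a')%MM.
  by rewrite mulrACA -mpolyCM -mpolyXD.
apply: contrapT => nz.
pose gs1 : seq R := [seq 'X_i | i <- enum 'I_n] ++ [seq c%:MP | c <- nonzero_coeffs f].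
have [|||r1 [good_r1 nz1 kr1]] := @socle_multiplier R H (zero_submod H) good (C *: h) gs1 good1 goodM.
- move=> g; rewrite mem_cat => /orP[] /mapP[x _ ->] //.
  by exists 1, U_(x)%MM; rewrite mpolyC1 mul1r.
- move=> g; rewrite mem_cat => /orP[] /mapP[x xin ->].
    have [t [r ->]] := u_onto (C *: h); exists t.
    by rewrite scalerA mulrC -scalerA u_killed scaler0.
  by have [k hk] := cnilp x xin (C *: h); exists k; rewrite -rmorphXn.
- exact: nz.
set z1 := r1 *: (C *: h) in nz1 kr1.
have Xz1 (i' : 'I_n) : 'X_i' *: z1 = 0.
  by apply: kr1; rewrite mem_cat; apply/orP; left; apply/mapP; exists i'; rewrite ?mem_enum.
have Jz1 : ideal_sub (ideal_gen (fun c => c \in nonzero_coeffs f))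
    (const_annihilator z1).
  apply: ideal_gen_sub => c cin; apply: kr1.
  by rewrite mem_cat; apply/orP; right; apply/mapP; exists c.
(* The second round makes [m] act by zero: its elements have powers in the coefficient ideal, which
   kills [z1] after the first round. *)
have [gs Mgs] := hN m.
have [|||r2 [good_r2 nz2 kr2]] :=
  @socle_multiplier R H (zero_submod H) good z1 [seq g%:MP | g <- gs] good1 goodM.
- by move=> _ /mapP[g _ ->].
- move=> _ /mapP[g gin ->]; have /mrad [k gk] : m g by apply/Mgs => J; apply.
  by exists k; rewrite -rmorphXn; exact: Jz1 gk.
- exact: nz1.
have soc : socle_mem (homog_max_ideal n m) (r2 *: z1).
  apply: (ideal_gen_sub (A := annihilator (r2 *: z1))) => r [[c mc ->]|].
    apply: (ideal_gen_sub (A := const_annihilator (r2 *: z1)) _ ((Mgs c).1 mc)) => g gin.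
    by apply: kr2; apply/mapP; exists g.
  apply: (ideal_gen_sub (A := annihilator (r2 *: z1))) => _ [i' ->].
  by rewrite /smem /= scalerA mulrC -scalerA Xz1 scaler0.
apply: nz2; have [r socE] := fin _ soc.
have [c [a rE]] := goodM _ _ good_r2 good_r1.
have zE : r2 *: z1 = C *: (c%:MP *: ('X_[a] *: h)).
  by rewrite !scalerA; congr (_ *: _); rewrite rE; ring.
have [ade|dea] := leqP (mdeg a) de; last by rewrite zE (hdeg_mulX0 dea hh) !scaler0.
have hch := hdeg_mulC c (hdeg_mulX ade hh).
have [le|lt] := leqP (de - mdeg a) (n * t0); first by rewrite zE; exact: small hch.
by apply: (hdeg_bounded socE _ lt); rewrite zE; exact: hdeg_mulC.
Qed.

End Generators.

(** * The test polynomial and the contradiction *)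

Lemma krull_dim_unique (T : comNzRingType) d d' : krull_dim T d -> krull_dim T d' -> d = d'.
Proof.
have le k k' : krull_dim T k -> krull_dim T k' -> (k' <= k)%N.
  move=> [_ nchain] [[c [cprime cinc]] _]; rewrite leqNgt; apply/negP => kk'; apply: nchain.
  exists c; split=> i ik; first by apply: cprime; exact: leq_trans ik kk'.
  by apply: cinc; exact: leq_trans ik kk'.
by move=> hd hd'; apply/eqP; rewrite eqn_leq !le.
Qed.

Section SignedSum.
Variables (T : comNzRingType) (n : nat) (J : ideal T) (c1 c2 : T) (a1 a2 : 'X_{1..n}) (s : nat).
Hypothesis a12 : a1 != a2.
Local Notation R := {mpoly T[n]}.
Local Notation U := (c1%:MP * 'X_[a1] : R).
Local Notation V := (c2%:MP * 'X_[a2] : R).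

(* The cofactor of [U + V] in [U^s - (-V)^s]. *)
Definition signed_sum : R := \sum_(i < s) U ^+ (s.-1 - i) * (- V) ^+ i.

Lemma signed_sumM : (U + V) * signed_sum = U ^+ s - (- V) ^+ s.
Proof. by rewrite subrXX opprK. Qed.

Lemma signed_sum_coef i : (i < s)%N ->
  signed_sum@_(a1 *+ (s.-1 - i) + a2 *+ i) = c1 ^+ (s.-1 - i) * (- c2) ^+ i.
Proof.
move=> is_; have termE (j : nat) : U ^+ (s.-1 - j) * (- V) ^+ j =
    (c1 ^+ (s.-1 - j) * (- c2) ^+ j)%:MP * 'X_[a1 *+ (s.-1 - j) + a2 *+ j].
  rewrite -mulNr -mpolyCN !exprMn !mpolyXn -!rmorphXn mpolyXD mpolyCM; ring.
rewrite raddf_sum /= (bigD1 (Ordinal is_)) //= big1 ?addr0 => [|j].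
  by rewrite termE mcoeffCM mcoeffX eqxx mulr1.
rewrite -val_eqE /= => ji; rewrite termE mcoeffCM mcoeffX.
(* The exponents lie on a line with nonzero direction [a2 - a1], so different indices give different
   monomials. *)
case: eqP => [E|_]; last by rewrite mulr0.
case/eqP: a12; apply/mnmP => l; move/mnmP/(_ l): E.
by rewrite !mnmDE !mulmnE; have := ltn_ord j; move/eqP: ji; nia.
Qed.

End SignedSum.

Theorem theorem1p1 (T : comNzRingType) (m : ideal T) (d n e : nat)
    (f : {mpoly T[n]})
    (hN : noetherian T) (hloc : is_local m)
    (hdim : krull_dim T d) (hd : (2 <= d)%N)
    (hhom : f \is e.-homog)
    (hsop : system_of_parameters m (nonzero_coeffs f))
    (E : injective_resolution (hypersurface f)) :
  ~ @finite_dimensional (quotring (homog_max_ideal n m))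
      (socle (homog_max_ideal n m)
         (local_cohomology (irrelevant_ideal T n) E n)).
Proof.
set H := local_cohomology _ _ _; set P := homog_max_ideal n m.
pose J : ideal {mpoly T[n]} := ideal_gen (fun r => r = f).
have one_scale (r : {mpoly T[n]}) : r *: (quotm_pi J 1 : hypersurface f) = quotm_pi J r.
  by rewrite -[r in RHS]mulr1 [RHS]quotm_piZ.
have pi_f : (quotm_pi J f : hypersurface f) = 0.
  by apply/quotm_piP; rewrite subr0 => J'; apply.
pose frac := fraction_class (@xvar_regular T n) E (@irrelevant_gammaP T n).
have fracZ t a mu : frac t (a *: mu) = a *: frac t mu.
  have lin := fraction_class_linear (@xvar_regular T n) E (@irrelevant_gammaP T n) t.
  have frac0 : frac t 0 = 0.
    have /eqP := lin 1 0 0; rewrite scaler0 addr0 scale1r -subr_eq subrr => /eqP h.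
    exact: esym h.
  by rewrite -[a *: mu]addr0 [LHS]lin [X in _ + X]frac0 addr0.
pose u t : H := frac t (quotm_pi J 1 : hypersurface f).
have fracE t r : r *: u t = frac t (quotm_pi J r : hypersurface f) by rewrite -fracZ one_scale.
have prodE s : (\prod_(i < n) xvar T n i) ^+ s = 'X_[box n s].
  rewrite mpolyXE_id -prodrXl; apply: eq_bigr => i _.
  by rewrite xvarE boxE.
have u_onto h : exists t r, h = r *: u t.
  have [t [mu ->]] := fraction_class_onto (@xvar_regular T n) (@irrelevant_gammaP T n) h.
  by exists t, (repr mu); rewrite fracE quotm_reprK.
have u_shift t s : 'X_[box n s] *: u (t + s)%N = u t.
  by rewrite -fracZ -prodE; exact: fraction_class_addn.
have u_killed t (i : 'I_n) : 'X_i ^+ t *: u t = 0.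
  by rewrite -xvarE; exact: fraction_class_killed.
have u_f t : f *: u t = 0.
  by rewrite fracE pi_f -(scale0r 0) fracZ scale0r.
have u_ker t r : r *: u t = 0 -> exists s (g : 'I_n -> {mpoly T[n]}) h,
    'X_[box n s] * r = \sum_(i < n) 'X_i ^+ (t + s) * g i + f * h.
  rewrite fracE => /fraction_class_eq0[s [g]]; rewrite prodE => E'.
  exists s, (fun i => repr (g i)).
  have : J ('X_[box n s] * r - \sum_(i < n) 'X_i ^+ (t + s) * repr (g i)).
    apply/quotm_piP; rewrite -[LHS]one_scale -scalerA one_scale E'.
    rewrite -[RHS]one_scale scaler_suml; apply: eq_bigr => i _.
    by rewrite -scalerA one_scale quotm_reprK xvarE.
  by move=> /ideal_gen1P[h hE]; exists h; rewrite -hE addrC subrK.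
move=> [K [v hv]].
pose sv (w : socle P H) : H := @subm_val _ _ (socle_submod P H) w.
have /fin_all_exists[tv /fin_all_exists[rv vE]] (i : 'I_K) : exists t r, sv (v i) = r *: u t.
  exact: u_onto.
(* A common denominator for the spanning vectors. *)
pose t0 := (\sum_i tv i)%N.
have fin (z : H) : socle_mem P z -> exists r, z = r *: u t0.
  move=> hz; have [a zE] := hv (@SubM _ _ (socle_submod P H) z (asboolT hz)).
  exists (\sum_i (repr (a i) : {mpoly T[n]}) * rv i * 'X_[box n (t0 - tv i)]).
  have -> : z = \sum_i (repr (a i) : {mpoly T[n]}) *: sv (v i).
    transitivity (sv (\sum_i a i *: v i)); first by rewrite -zE.
    exact: (big_morph sv (fun _ _ => erefl) erefl).
  rewrite scaler_suml; apply: eq_bigr => i _.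
  have tvi : (tv i <= t0)%N by rewrite /t0 (bigD1 i) //= leq_addr.
  by rewrite vE -!scalerA -{2}(subnKC tvi) u_shift.
have dE := krull_dim_unique hsop.1 hdim.
move: hd hsop; rewrite -dE /nonzero_coeffs size_map.
case Ef: (msupp f) => [//|a1 [//|a2 al]] _ /= sop.
set c1 := f@_a1 in sop; set c2 := f@_a2 in sop; set cs := map _ _ in sop.
have c1f : c1 \in nonzero_coeffs f by apply: map_f; rewrite Ef inE eqxx.
have c2f : c2 \in nonzero_coeffs f by apply: map_f; rewrite Ef !inE eqxx orbT.
have mrad c : m c -> exists k, ideal_gen (fun c => c \in nonzero_coeffs f) (c ^+ k).
  by move=> mc; rewrite /nonzero_coeffs Ef; exact: (sop.2.2 c).1 mc.
have [k hk] := hdeg_killed u_onto u_shift u_killed u_f u_ker hhom hN mrad c1f c2f fin.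
have [Q [_ Qcs /(_ k)[s [a [b [s0 abE nJ]]]]]] := sop_monomials hN hloc sop.
apply: nJ; set J' := iadj _ _.
have J1 : J' (c1 ^+ s) by apply: iadj_sub; exact: iadj_mem.
have J2 : J' (c2 ^+ s) by exact: iadj_mem.
have [sa|as_] := leqP s a.
  by rewrite -(subnK sa) exprD mulrAC; exact: ideal_mull.
have [sb|bs] := leqP s b.
  by rewrite -(subnK sb) exprD mulrA; exact: ideal_mull.
have : uniq (msupp f) by exact: msupp_uniq.
rewrite Ef /= inE negb_or => /andP[/andP[a12 _] _].
pose w := signed_sum c1 c2 a1 a2 s.
(* Modulo [Q] only the terms of [f] at [a1] and [a2] remain, and [w] turns their sum into a
   difference of [s]-th powers. *)
have Jfw a' : J' (f * w)@_a'.
  pose rest := \sum_(x <- al) f@_x *: 'X_[x].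
  have -> : f = c1%:MP * 'X_[a1] + c2%:MP * 'X_[a2] + rest.
    by rewrite {1}(mpolyE f) Ef !big_cons !mul_mpolyC addrA.
  rewrite mulrDl signed_sumM -mulNr -mpolyCN !exprMn !mpolyXn -!rmorphXn mcoeffD mcoeffB.
  rewrite !mcoeffCM; apply: smemD.
    apply: idealB; apply: ideal_mulr => //.
    by rewrite exprNn; exact: ideal_mull.
  apply: mcoeff_mul_ideal => a''; rewrite raddf_sum /= big_seq.
  apply: (@ideal_sum _ J') => x xal.
  rewrite mcoeffZ; apply: ideal_mulr; do 2!apply: iadj_sub.
  by apply: Qcs; exact: map_f.
(* The term of [w] with index [b] supplies [c1 ^+ (s.-1 - b) * c2 ^+ b] up to sign. The missing
   power of [c1] has exponent [a - (s.-1 - b) = k.+1], enough to kill [psi]. *)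
have ks : (k <= (a - (s.-1 - b)) + 0)%N by lia.
have := hk _ _ _ _ (hdeg_psi u (a1 *+ (s.-1 - b) + a2 *+ b)%MM) ks.
move=> /(mcoeff_psi_kernel u_ker Jfw).
rewrite signed_sum_coef // expr0 mulr1 mulrA -exprD exprNn mulrCA => h.
have -> : c1 ^+ a * c2 ^+ b =
    (-1) ^+ b * ((-1) ^+ b * (c1 ^+ (a - (s.-1 - b) + (s.-1 - b)) * c2 ^+ b)).
  by rewrite signrMK subnK //; lia.
exact: ideal_mull h.
Qed.
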